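(* For a positive integer $n$ let $G_n = \{ g \in C\ell(n) : g \cdot c(g) = c(g) \cdot g = 1\}$, a group under multiplication. Let $k \geq 0$ be an integer, and let $\approx$ denote group isomorphism. Then (for every index below that is a positive integer): 1) $G_{8k} \approx O(2^{4k}, \mathbb{R})$; 2) $G_{8k+1} \approx U(2^{4k})$; 3) $G_{8k+2} \approx Sp(2^{4k})$; 4) $G_{8k+3} \approx Sp(2^{4k}) \times Sp(2^{4k})$; 5) $G_{8k+4} \approx Sp(2^{4k+1})$; 6) $G_{8k+5} \approx U(2^{4k+2})$; 7) $G_{8k+6} \approx O(2^{4k+3}, \mathbb{R})$; 8) $G_{8k+7} \approx O(2^{4k+3}, \mathbb{R}) \times O(2^{4k+3}, \mathbb{R})$. In particular, $G_n$ is compact for all positive integers $n$.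
   Context: $C\ell(n)$ denotes the Clifford algebra of $\mathbb{R}^n$ with the standard positive definite form $Q(e_i,e_j)=\delta_{ij}$, with the sign convention $v^2 = -Q(v,v)1$; i.e. the universal associative unital real algebra containing $\mathbb{R}^n$ in which $v\cdot v = -Q(v,v)1$ for all $v\in\mathbb{R}^n$ (so $e_i^2=-1$ and $e_ie_j=-e_je_i$ for $i\ne j$). It has real dimension $2^n$, and subsets of it carry the topology of a finite dimensional real vector space. The map $c : C\ell(n) \to C\ell(n)$ is the unique algebra anti-automorphism with $c(v) = -v$ for all $v \in \mathbb{R}^n$. For a positive integer $m$: $O(m,\mathbb{R})$, $U(m)$, $Sp(m)$ denote the groups $\{g \in M(m,K) : g g^* = g^* g = 1\}$ for $K=\mathbb{R}$, $\mathbb{C}$, $\mathbb{H}$ (quaternions) respectively, where $M(m,K)$ is the algebra of $m\times m$ matrices over $K$ and $g^*$ is the conjugate transpose. *)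

(* Defs.v *)
From HB Require Import structures.
From mathcomp Require Import all_boot all_order all_algebra.
From mathcomp Require Import falgebra complex ring.
From mathcomp Require Import boolp classical_sets reals topology normedtype.

Set Implicit Arguments.
Unset Strict Implicit.
Unset Printing Implicit Defensive.

Import Order.TTheory GRing.Theory Num.Theory.
Import numFieldNormedType.Exports.

Local Open Scope ring_scope.

Section ConverseAlgebra.
Variable K : comNzRingType.

HB.instance Definition _ (V : lmodType K) := GRing.Lmodule.on V^c.

Variable A : algType K.

Fact conv_scalerAl (a : K) (u v : A^c) :
  a *: (u * v) = @GRing.mul A^c (a *: u) v.
Proof. exact: (@scalerAr K A a v u). Qed.
HB.instance Definition _ :=
  GRing.LSemiModule_isLSemiAlgebra.Build K A^c conv_scalerAl.

Fact conv_scalerAr (a : K) (u v : A^c) :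
  a *: (u * v) = @GRing.mul A^c u (a *: v).
Proof. exact: (@scalerAl K A a v u). Qed.
HB.instance Definition _ :=
  GRing.LSemiAlgebra_isSemiAlgebra.Build K A^c conv_scalerAr.

End ConverseAlgebra.

(* A ring morphism [A -> A^c] is an anti-endomorphism of [A]: the lemma [antiM]
   below spells this out. *)
Lemma antiM (A : pzRingType) (s : {rmorphism A -> A^c}) (x y : A) :
  s (x * y) = (s y : A) * (s x : A) :> A.
Proof. by rewrite rmorphM. Qed.

Section UnitaryGroup.
Variables (A : pzRingType) (s : {rmorphism A -> A^c}).

Definition in_unitary : pred A :=
  fun g => (g * (s g : A) == 1) && ((s g : A) * g == 1).

Record unitary := Unitary { unitary_val :> A; _ : in_unitary unitary_val }.

HB.instance Definition _ := [isSub for unitary_val].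
HB.instance Definition _ := [Choice of unitary by <:].

Fact unitary_one_subproof : in_unitary 1.
Proof. by rewrite /in_unitary rmorph1 mulr1 eqxx. Qed.
Definition unitary_one := Unitary unitary_one_subproof.

Fact unitary_mul_subproof (g h : unitary) : in_unitary (val g * val h).
Proof.
case: g h => [g /andP[/eqP g1 /eqP g2]] [h /andP[/eqP h1 /eqP h2]] /=.
rewrite /in_unitary antiM; apply/andP; split; apply/eqP.
  by rewrite mulrA -(mulrA g) h1 mulr1.
by rewrite mulrA -(mulrA (s h : A)) g2 mulr1.
Qed.
Definition unitary_mul g h := Unitary (unitary_mul_subproof g h).

Fact unitary_inv_subproof (g : unitary) : in_unitary (s (val g)).
Proof.
case: g => [g /andP[/eqP g1 /eqP g2]] /=.
by rewrite /in_unitary -!antiM g1 g2 rmorph1 eqxx.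
Qed.
Definition unitary_inv g := Unitary (unitary_inv_subproof g).

Fact unitary_mulA : associative unitary_mul.
Proof. by move=> f g h; apply/val_inj; rewrite /= mulrA. Qed.
Fact unitary_mul1 : left_id unitary_one unitary_mul.
Proof. by move=> g; apply/val_inj; rewrite /= mul1r. Qed.
Fact unitary_mulr1 : right_id unitary_one unitary_mul.
Proof. by move=> g; apply/val_inj; rewrite /= mulr1. Qed.
Fact unitary_mulV : left_inverse unitary_one unitary_inv unitary_mul.
Proof. by case=> g gU; apply/val_inj; case/andP: (gU) => _ /eqP. Qed.
Fact unitary_mulrV : right_inverse unitary_one unitary_inv unitary_mul.
Proof. by case=> g gU; apply/val_inj; case/andP: (gU) => /eqP. Qed.

HB.instance Definition _ := isGroup.Build unitary
  unitary_mulA unitary_mul1 unitary_mulr1 unitary_mulV unitary_mulrV.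

End UnitaryGroup.

Definition group_isomorphic (G H : groupType) : Prop :=
  exists f : {multiplicative G -> H}, bijective f.

Section ConjugateTranspose.
Variables (K : pzRingType) (s : {rmorphism K -> K^c}) (m : nat).

Definition conjtr (M : 'M[K]_m) : ('M[K]_m)^c := \matrix_(i, j) (s (M j i) : K).

Fact conjtr_zmod : zmod_morphism conjtr.
Proof. by move=> M N; apply/matrixP => i j; rewrite !mxE rmorphB. Qed.
HB.instance Definition _ :=
  GRing.isZmodMorphism.Build 'M[K]_m ('M[K]_m)^c conjtr conjtr_zmod.

Fact conjtr_monoid : monoid_morphism conjtr.
Proof.
split; first by apply/matrixP => i j; rewrite !mxE rmorph_nat eq_sym.
move=> M N; apply/matrixP => i j; rewrite !mxE rmorph_sum.
by apply: eq_bigr => k _; rewrite antiM !mxE.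
Qed.
HB.instance Definition _ :=
  GRing.isMonoidMorphism.Build 'M[K]_m ('M[K]_m)^c conjtr conjtr_monoid.

End ConjugateTranspose.

(* [Quat a b c d] is [a + b i + c j + d k], with [i^2 = j^2 = k^2 = i j k = -1]. *)
Record quat (R : Type) := Quat { qre : R; qi : R; qj : R; qk : R }.

Section Quaternions.
Variable R : comNzRingType.

Definition quat_tuple (x : quat R) := (qre x, qi x, qj x, qk x).
Definition tuple_quat (x : R * R * R * R) :=
  let: (a, b, c, d) := x in Quat a b c d.
Fact quat_tupleK : cancel quat_tuple tuple_quat. Proof. by case. Qed.
HB.instance Definition _ := Choice.copy (quat R) (can_type quat_tupleK).

Definition addq (x y : quat R) :=
  Quat (qre x + qre y) (qi x + qi y) (qj x + qj y) (qk x + qk y).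
Definition oppq (x : quat R) := Quat (- qre x) (- qi x) (- qj x) (- qk x).
Definition mulq (x y : quat R) :=
  Quat (qre x * qre y - qi x * qi y - qj x * qj y - qk x * qk y)
       (qre x * qi y + qi x * qre y + qj x * qk y - qk x * qj y)
       (qre x * qj y - qi x * qk y + qj x * qre y + qk x * qi y)
       (qre x * qk y + qi x * qj y - qj x * qi y + qk x * qre y).

Fact addqA : associative addq.
Proof. by case=> ? ? ? ? [? ? ? ?] [? ? ? ?]; congr Quat; rewrite /= addrA. Qed.
Fact addqC : commutative addq.
Proof. by case=> ? ? ? ? [? ? ? ?]; congr Quat; rewrite /= addrC. Qed.
Fact add0q : left_id (Quat 0 0 0 0) addq.
Proof. by case=> ? ? ? ?; rewrite /addq /= !add0r. Qed.
Fact addNq : left_inverse (Quat 0 0 0 0) oppq addq.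
Proof. by case=> ? ? ? ?; rewrite /addq /= !addNr. Qed.
HB.instance Definition _ :=
  GRing.isZmodule.Build (quat R) addqA addqC add0q addNq.

Fact mulqA : associative mulq.
Proof. by case=> ? ? ? ? [? ? ? ?] [? ? ? ?]; congr Quat; rewrite /=; ring. Qed.
Fact mul1q : left_id (Quat 1 0 0 0) mulq.
Proof. by case=> ? ? ? ?; congr Quat; rewrite /=; ring. Qed.
Fact mulq1 : right_id (Quat 1 0 0 0) mulq.
Proof. by case=> ? ? ? ?; congr Quat; rewrite /=; ring. Qed.
Fact mulqDl : left_distributive mulq +%R.
Proof. by case=> ? ? ? ? [? ? ? ?] [? ? ? ?]; congr Quat; rewrite /=; ring. Qed.
Fact mulqDr : right_distributive mulq +%R.
Proof. by case=> ? ? ? ? [? ? ? ?] [? ? ? ?]; congr Quat; rewrite /=; ring. Qed.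
Fact oneq_neq0 : Quat 1 0 0 0 != 0 :> quat R.
Proof. by apply/eqP => -[] /eqP; rewrite oner_eq0. Qed.
HB.instance Definition _ := GRing.Zmodule_isNzRing.Build (quat R)
  mulqA mul1q mulq1 mulqDl mulqDr oneq_neq0.

End Quaternions.

(* The conjugations of the reals, the complex numbers and the quaternions, all
   three seen as anti-automorphisms. *)
Section Conjugations.
Variable R : rcfType.

Definition conjR (x : R) : R^c := x.
Fact conjR_zmod : zmod_morphism conjR. Proof. by []. Qed.
Fact conjR_monoid : monoid_morphism conjR.
Proof. by split=> // x y; rewrite /conjR mulrC. Qed.
HB.instance Definition _ := GRing.isZmodMorphism.Build R R^c conjR conjR_zmod.
HB.instance Definition _ :=
  GRing.isMonoidMorphism.Build R R^c conjR conjR_monoid.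

Definition conjC (z : R[i]) : R[i]^c := conjc z.
Fact conjC_zmod : zmod_morphism conjC.
Proof. by move=> x y; rewrite /conjC rmorphB. Qed.
Fact conjC_monoid : monoid_morphism conjC.
Proof. by split=> [|x y]; rewrite /conjC ?rmorph1 // mulrC rmorphM. Qed.
HB.instance Definition _ :=
  GRing.isZmodMorphism.Build R[i] R[i]^c conjC conjC_zmod.
HB.instance Definition _ :=
  GRing.isMonoidMorphism.Build R[i] R[i]^c conjC conjC_monoid.

Definition conjH (x : quat R) : (quat R)^c :=
  Quat (qre x) (- qi x) (- qj x) (- qk x).
Fact conjH_zmod : zmod_morphism conjH.
Proof. by case=> ? ? ? ? [? ? ? ?]; congr Quat; rewrite /=; ring. Qed.
Fact conjH_monoid : monoid_morphism conjH.
Proof.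
split=> [|[? ? ? ?] [? ? ? ?]]; first by rewrite /conjH /= !oppr0.
by congr Quat; rewrite /=; ring.
Qed.
HB.instance Definition _ :=
  GRing.isZmodMorphism.Build (quat R) (quat R)^c conjH conjH_zmod.
HB.instance Definition _ :=
  GRing.isMonoidMorphism.Build (quat R) (quat R)^c conjH conjH_monoid.

End Conjugations.

Definition orthogonal_group (R : rcfType) (m : nat) : groupType :=
  unitary (@conjtr R (@conjR R) m).
Definition unitary_group (R : rcfType) (m : nat) : groupType :=
  unitary (@conjtr R[i] (@conjC R) m).
Definition symplectic_group (R : rcfType) (m : nat) : groupType :=
  unitary (@conjtr (quat R) (@conjH R) m).

Section CliffordAlgebra.
Variables (R : realType) (n : nat).

Definition euclid_form (v w : 'rV[R]_n) : R := \sum_i v 0 i * w 0 i.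

Definition clifford_map (B : algType R) (f : {linear 'rV[R]_n -> B}) : Prop :=
  forall v, f v * f v = - euclid_form v v *: 1.

(* [iota : R^n -> A] presents [A] as the universal associative unital real
   algebra containing [R^n] in which [v * v = - Q(v,v) 1].  Such algebras exist:
   see [clifford_algebra_exists]. *)
Definition clifford_algebra (A : algType R) (iota : {linear 'rV[R]_n -> A}) :=
  [/\ injective iota,
      clifford_map iota
    & forall (B : algType R) (f : {linear 'rV[R]_n -> B}), clifford_map f ->
        exists2 F : {lrmorphism A -> B}, F \o iota =1 f
          & forall F' : {lrmorphism A -> B}, F' \o iota =1 f -> F' =1 F].

Lemma euclid_form_delta i j :
  euclid_form (delta_mx 0 i) (delta_mx 0 j) = (i == j)%:R.
Proof.
rewrite /euclid_form (bigD1 i) //= !mxE !eqxx mul1r big1 ?addr0 // => k ki.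
by rewrite !mxE (negbTE ki) andbF mul0r.
Qed.

Lemma clifford_mapD (B : algType R) (f : {linear 'rV[R]_n -> B}) :
  clifford_map f ->
  forall v w, f v * f w + f w * f v = (- euclid_form v w *+ 2) *: 1.
Proof.
move=> fP v w; have := fP (v + w).
have -> : euclid_form (v + w) (v + w) =
    euclid_form v v + euclid_form w w + euclid_form v w *+ 2.
  rewrite mulr2n /euclid_form -!big_split; apply: eq_bigr => i _ /=.
  by rewrite !mxE; ring.
rewrite linearD mulrDl !mulrDr !fP mulNrn !opprD !scalerDl.
rewrite addrA -(addrA (_ *: 1)) addrAC.
by move/addrI.
Qed.

Definition clifford_conj (A : algType R) (iota : {linear 'rV[R]_n -> A})
    (c : {lrmorphism A -> A^c}) : Prop :=
  bijective c /\ forall v, c (iota v) = - iota v.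

End CliffordAlgebra.

(* The topology of a finite dimensional real vector space [V] is the one carried
   over from [R^m] by any linear isomorphism [V -> R^m]. *)
Definition fd_compact (R : realType) (V : vectType R) (S : set V) : Prop :=
  forall (m : nat) (phi : {linear V -> 'rV[R]_m}), bijective phi ->
    compact [set phi x | x in S].

(* A model of the Clifford algebra, showing that the universal property above is
   satisfiable: the basis vector of index [A : 'I_n -> bool] is the product, in
   increasing order, of the [e_i] with [A i], and the product of the basis
   vectors of indices [A] and [B] is [(-1) ^ csign (enum 'I_n) A B] times the
   one of index [A + B]. *)
Section CliffordSign.
Variable n : nat.
Local Notation index := {ffun 'I_n -> bool}.
Implicit Types (A B C : index) (s : seq 'I_n).

Fixpoint parity s A : bool := if s is i :: s' then A i (+) parity s' A else false.

Fixpoint csign s A B : bool :=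
  if s is i :: s' then (B i && parity s A) (+) csign s' A B else false.

Lemma parityD s A B : parity s (A + B) = parity s A (+) parity s B.
Proof. by elim: s => //= i s ->; rewrite ffunE /= [A i + B i]/(_ (+) _) addbACA. Qed.

Lemma csignDl s A B C : csign s (A + B) C = csign s A C (+) csign s B C.
Proof.
elim: s => //= i s ->; rewrite parityD ffunE /= [A i + B i]/(_ (+) _).
by rewrite (addbACA (A i)) andb_addr addbACA.
Qed.

Lemma csignDr s A B C : csign s A (B + C) = csign s A B (+) csign s A C.
Proof.
elim: s => //= i s ->; rewrite ffunE /= [B i + C i]/(_ (+) _).
by rewrite andb_addl addbACA.
Qed.

Lemma csign0l s A : csign s 0 A = false.
Proof.
have p0 s' : parity s' 0 = false by elim: s' => //= i s' ->; rewrite ffunE.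
by elim: s => //= i s ->; rewrite p0 ffunE andbF.
Qed.

Lemma csign0r s A : csign s A 0 = false.
Proof. by elim: s => //= i s ->; rewrite ffunE. Qed.

Lemma csign_swap s A B : csign s A B =
  csign s B A (+) (parity s A && parity s B) (+) parity s [ffun i => A i && B i].
Proof.
elim: s => //= i s ->; rewrite ffunE.
move: (parity s [ffun _ => _]) => p.
by case: (A i) (B i) (parity s A) (parity s B) p (csign s B A) =>
  [] [] [] [] [] [].
Qed.

Definition sing (i : 'I_n) : index := [ffun j => j == i].

Lemma parity_sing s i : uniq s -> parity s (sing i) = (i \in s).
Proof.
elim: s => //= j s IH /andP[js us]; rewrite IH // ffunE in_cons.
by rewrite (eq_sym i); case: eqP => [<-|//]; rewrite (negbTE js).
Qed.

Lemma csign_notin s i A : i \notin s -> csign s (sing i) A = false.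
Proof.
elim: s => //= j s IH; rewrite in_cons negb_or => /andP[ij iNs].
rewrite IH // ffunE eq_sym (negbTE ij) /= addbF.
suff -> : parity s (sing i) = false by rewrite andbF.
elim: s iNs {IH} => //= k s IH; rewrite in_cons negb_or => /andP[ik /IH ->].
by rewrite ffunE eq_sym (negbTE ik).
Qed.

Lemma csign_sing i : csign (enum 'I_n) (sing i) (sing i).
Proof.
have : uniq (enum 'I_n) by exact: enum_uniq.
have : i \in enum 'I_n by rewrite mem_enum.
elim: (enum 'I_n) => //= j s IH; rewrite in_cons !ffunE => /orP[/eqP <-|i_s].
  by move=> /andP[iNs us]; rewrite eqxx parity_sing //= (negbTE iNs) csign_notin.
by move=> /andP[js us]; rewrite IH //; case: eqP js i_s => // -> /negbTE->.
Qed.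

Lemma csign_sing_swap i j : i != j ->
  csign (enum 'I_n) (sing i) (sing j) = ~~ csign (enum 'I_n) (sing j) (sing i).
Proof.
move=> ij; rewrite csign_swap !parity_sing ?enum_uniq // !mem_enum /=.
have -> : [ffun k => sing i k && sing j k] = 0 :> index.
  by apply/ffunP => k; rewrite !ffunE; case: eqP => //= ->; apply: negbTE.
have -> : parity (enum 'I_n) 0 = false.
  by elim: (enum _) => //= k s ->; rewrite ffunE.
by rewrite addbF addbT.
Qed.

Definition restr s A : index := [ffun i => (i \in s) && A i].

Lemma csign_restr s0 i s1 A : uniq (s0 ++ i :: s1) ->
  csign (s0 ++ i :: s1) (sing i) (restr s1 A) = false.
Proof.
elim: s0 => [|j s0 IH] /=.
  move=> /andP[iNs _]; rewrite ffunE (negbTE iNs) /=.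
  exact: csign_notin.
rewrite mem_cat in_cons !negb_or => /andP[/and3P[_ _ js1] us].
by rewrite IH // ffunE (negbTE js1).
Qed.

End CliffordSign.

Section CliffordProducts.
Variables (R : pzRingType) (B : algType R) (n : nat) (g : 'I_n -> B).
Local Notation index := {ffun 'I_n -> bool}.
Implicit Types (A C : index) (s : seq 'I_n).

Definition clprod s A : B := \prod_(i <- s) (if A i then g i else 1).

Hypothesis g_sqr : forall i, g i * g i = -1.
Hypothesis g_anti : forall i j, i != j -> g i * g j = - (g j * g i).

Lemma mulr_signCA (b : bool) (x y : B) :
  x * ((-1) ^+ b * y) = (-1) ^+ b * (x * y).
Proof. by rewrite mulrA commr_sign -mulrA. Qed.

Lemma clprod_comm s A i : i \notin s ->
  clprod s A * g i = (-1) ^+ parity s A * (g i * clprod s A).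
Proof.
elim: s => [|j s IH]; rewrite /clprod ?big_nil ?mul1r ?mulr1 // !big_cons.
rewrite in_cons negb_or => /andP[ij /IH {}IH]; rewrite -/(clprod s A) in IH *.
rewrite /= -mulrA IH mulr_signCA addbC signr_addb -mulrA; congr (_ * _).
case: (A j) => /=; rewrite ?mul1r // mulN1r.
by rewrite !mulrA g_anti 1?eq_sym // mulNr.
Qed.

Lemma clprodM s A C : uniq s ->
  clprod s A * clprod s C = (-1) ^+ csign s A C * clprod s (A + C).
Proof.
elim: s => [|i s IH]; rewrite /clprod ?big_nil ?mul1r ?mulr1 // !big_cons.
rewrite -!/(clprod _ _) => /andP[iNs /IH {}IH].
rewrite ffunE /= [A i + C i]/(_ (+) _) mulrA -(mulrA _ (clprod s A)).
case: (C i) => /=; last first.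
  by rewrite mulr1 -mulrA IH mulr_signCA; case: (A i).
rewrite clprod_comm // mulr_signCA -!mulrA IH (mulr_signCA _ (g i)).
rewrite (mulr_signCA _ (if A i then _ else _)) !signr_addb -!mulrA.
case: (A i) => /=; last by rewrite !mul1r.
by rewrite mul1r (mulrA (g i)) g_sqr !mulN1r !mulrN.
Qed.

Lemma clprod_sing s i : uniq s -> i \in s -> clprod s (sing i) = g i.
Proof.
move=> us i_s; rewrite /clprod; under eq_bigr do rewrite ffunE.
by rewrite -big_mkcond -big_filter filter_pred1_uniq // big_seq1.
Qed.

End CliffordProducts.

Section CliffordModel.
Variables (R : realType) (n : nat).
Local Notation index := {ffun 'I_n -> bool}.
Local Notation sgn A B := ((-1) ^+ csign (enum 'I_n) A B : R).
Implicit Types (A B C : index).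

Definition clmodel := {ffun index -> R^o}.
HB.instance Definition _ := Vector.on clmodel.
Implicit Types (x y z : clmodel).

Definition clmodel1 : clmodel := [ffun A : index => (A == 0)%:R : R^o].
Definition clmul x y : clmodel :=
  [ffun C : index =>
    \sum_(A : index) sgn A (C - A) * x A * y (C - A) : R^o].

Fact clmulA : associative clmul.
Proof.
move=> x y z; apply/ffunP => D; rewrite !ffunE.
under eq_bigr => A _.
  rewrite ffunE mulr_sumr (reindex_inj (addIr (- A))) /=.
  under eq_bigr => C _.
    rewrite [D - A - _](_ : _ = D - C); last by rewrite opprB addrA subrK.
    over.
  over.
rewrite exchange_big; apply: eq_bigr => C _ /=.
rewrite ffunE mulr_sumr mulr_suml; apply: eq_bigr => A _ /=.
have -> : D - A = (C - A) + (D - C) by rewrite [RHS]addrC addrA subrK.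
have -> : sgn A (C - A + (D - C)) = sgn A (C - A) * sgn A (D - C).
  by rewrite csignDr signr_addb.
have -> : sgn C (D - C) = sgn A (D - C) * sgn (C - A) (D - C).
  by rewrite -signr_addb -csignDl [A + _]addrC subrK.
ring.
Qed.

Fact clmul1 : left_id clmodel1 clmul.
Proof.
move=> x; apply/ffunP => C; rewrite ffunE (bigD1 (0 : index)) //= big1 => [|A /negbTE A0].
  by rewrite ffunE eqxx subr0 csign0l addr0 !mul1r.
by rewrite ffunE A0 mulr0 mul0r.
Qed.

Fact clmulr1 : right_id clmodel1 clmul.
Proof.
move=> x; apply/ffunP => C; rewrite ffunE (bigD1 C) //= big1 => [|A AC].
  by rewrite ffunE subrr eqxx csign0r addr0 mul1r mulr1.
by rewrite ffunE subr_eq0 eq_sym (negbTE AC) mulr0.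
Qed.

Fact clmulDl : left_distributive clmul +%R.
Proof.
move=> x y z; apply/ffunP => C; rewrite !ffunE -big_split.
by apply: eq_bigr => A _ /=; rewrite ffunE -mulrDl -mulrDr.
Qed.

Fact clmulDr : right_distributive clmul +%R.
Proof.
move=> x y z; apply/ffunP => C; rewrite !ffunE -big_split.
by apply: eq_bigr => A _ /=; rewrite ffunE -mulrDr.
Qed.

Fact clmodel1_neq0 : clmodel1 != 0.
Proof. by apply/eqP => /ffunP /(_ 0); rewrite !ffunE eqxx => /eqP; rewrite oner_eq0. Qed.

HB.instance Definition _ := GRing.Zmodule_isNzRing.Build clmodel
  clmulA clmul1 clmulr1 clmulDl clmulDr clmodel1_neq0.

Fact clscalerAl (a : R) (x y : clmodel) : a *: (x * y) = (a *: x) * y.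
Proof.
apply/ffunP => C; rewrite !ffunE [_ *: _]mulr_sumr; apply: eq_bigr => A _.
by rewrite ffunE; change (a *: x A) with (a * x A : R); rewrite [_ * (a * _)]mulrCA -!mulrA.
Qed.
HB.instance Definition _ :=
  GRing.Lmodule_isLalgebra.Build R clmodel clscalerAl.

Fact clscalerAr (a : R) (x y : clmodel) : a *: (x * y) = x * (a *: y).
Proof.
apply/ffunP => C; rewrite !ffunE [_ *: _]mulr_sumr; apply: eq_bigr => A _.
by rewrite ffunE; change (a *: y (C - A)) with (a * y (C - A) : R); rewrite [RHS]mulrCA.
Qed.
HB.instance Definition _ :=
  GRing.Lalgebra_isAlgebra.Build R clmodel clscalerAr.
HB.instance Definition _ := Algebra_isFalgebra.Build R clmodel.


Definition clbas A : clmodel := [ffun C : index => (C == A)%:R : R^o].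

Lemma clbasM A C : clbas A * clbas C = sgn A C *: clbas (A + C).
Proof.
apply/ffunP => D; rewrite !ffunE (bigD1 A) //= big1 => [|E /negbTE EA].
  rewrite !ffunE eqxx mulr1 addr0 subr_eq (addrC C).
  change (sgn A (D - A) * (D == A + C)%:R = sgn A C * (D == A + C)%:R).
  by case: eqP => [->|_]; rewrite ?mulr0 // (addrC A) addrK.
by rewrite !ffunE EA mulr0 mul0r.
Qed.

Lemma clmodelE x : x = \sum_(A : index) (x A : R) *: clbas A.
Proof.
apply/ffunP => C; rewrite sum_ffunE (bigD1 C) //= big1 => [|A AC].
  by rewrite !ffunE eqxx addr0 /GRing.scale /= mulr1.
by rewrite !ffunE eq_sym (negbTE AC) /GRing.scale /= mulr0.
Qed.

Definition cliota (v : 'rV[R]_n) : clmodel := \sum_i v 0 i *: clbas (sing i).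

Fact cliota_linear : linear cliota.
Proof.
move=> a u v; rewrite /cliota scaler_sumr -big_split; apply: eq_bigr => i _ /=.
by rewrite !mxE scalerDl scalerA.
Qed.
HB.instance Definition _ :=
  GRing.isLinear.Build R 'rV[R]_n clmodel _ cliota cliota_linear.

Lemma cliota_delta i : cliota (delta_mx 0 i) = clbas (sing i).
Proof.
rewrite /cliota (bigD1 i) //= big1 => [|j /negbTE ji].
  by rewrite mxE !eqxx scale1r addr0.
by rewrite mxE ji andbF scale0r.
Qed.

Lemma sing_inj : injective (@sing n).
Proof. by move=> i j /ffunP /(_ i); rewrite !ffunE eqxx; case: eqP. Qed.

Lemma cliota_inj : injective cliota.
Proof.
move=> u v /ffunP uv; apply/rowP => i.
have E w : cliota w (sing i) = w 0 i.
  rewrite /cliota sum_ffunE (bigD1 i) //= big1 => [|j ji].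
    by rewrite !ffunE eqxx addr0 /GRing.scale /= mulr1.
  rewrite !ffunE (inj_eq sing_inj) eq_sym (negbTE ji).
  by rewrite /GRing.scale /= mulr0.
by rewrite -!E.
Qed.

Lemma clbas0 : clbas 0 = 1. Proof. by []. Qed.

Lemma sing2 i : sing i + sing i = 0 :> index.
Proof. by apply/ffunP => j; rewrite !ffunE; case: eqP. Qed.

Lemma clbas_anti i j :
  clbas (sing i) * clbas (sing j) + clbas (sing j) * clbas (sing i) =
  - ((i == j)%:R *+ 2) *: 1.
Proof.
rewrite !clbasM; case: eqVneq => [->|ij].
  rewrite sing2 clbas0 csign_sing expr1 -scalerDl; congr (_ *: _).
  by rewrite mulr2n opprD.
rewrite (csign_sing_swap ij) (addrC (sing j)) -scalerDl mul0rn oppr0.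
by case: csign; rewrite /= ?expr0 ?expr1 ?subrr ?addNr !scale0r.
Qed.

Lemma cliota_clifford : clifford_map cliota.
Proof.
move=> v; have two : (2 : R) != 0 by rewrite pnatr_eq0.
apply: (scalerI two); rewrite !scaler_nat mulr2n.
have E : cliota v * cliota v = \sum_i \sum_j
    (v 0 i * v 0 j) *: (clbas (sing i) * clbas (sing j)).
  rewrite /cliota mulr_suml; apply: eq_bigr => i _; rewrite mulr_sumr.
  by apply: eq_bigr => j _; rewrite -scalerAl -scalerAr scalerA.
rewrite {1}E exchange_big E -big_split /=.
under eq_bigr => i _.
  rewrite -big_split /= (bigD1 i) //= big1 => [|j ji]; last first.
    by rewrite (mulrC (v 0 j)) -scalerDr clbas_anti (negbTE ji) mul0rn oppr0 scale0r scaler0.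
  rewrite -scalerDr clbas_anti eqxx addr0 scalerA.
  over.
rewrite -scaler_suml scalerMnl; congr (_ *: _).
rewrite /euclid_form -sumrN -sumrMnl; apply: eq_bigr => i _.
by rewrite mulrN mulrnAr mulr1 mulNrn.
Qed.

Section Lift.
Variables (B : algType R) (f : {linear 'rV[R]_n -> B}).
Hypothesis fP : clifford_map f.

Let g i := f (delta_mx 0 i).

Fact lift_sqr i : g i * g i = -1.
Proof. by rewrite /g fP euclid_form_delta eqxx scaleN1r. Qed.

Fact lift_anti i j : i != j -> g i * g j = - (g j * g i).
Proof.
move=> /negbTE ij; apply/eqP; rewrite -addr_eq0 clifford_mapD //.
by rewrite euclid_form_delta ij oppr0 mul0rn scale0r.
Qed.

Definition cllift x : B :=
  \sum_(A : index) (x A : R) *: clprod g (enum 'I_n) A.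

Fact cllift_linear : linear cllift.
Proof.
move=> a x y; rewrite /cllift scaler_sumr -big_split; apply: eq_bigr => i _ /=.
by rewrite !ffunE scalerDl scalerA.
Qed.

Lemma cllift_bas A : cllift (clbas A) = clprod g (enum 'I_n) A.
Proof.
rewrite /cllift (bigD1 A) //= big1 => [|C /negbTE CA].
  by rewrite ffunE eqxx scale1r addr0.
by rewrite ffunE CA scale0r.
Qed.

HB.instance Definition _ :=
  GRing.isLinear.Build R clmodel B _ cllift cllift_linear.

Fact cllift_monoid : monoid_morphism cllift.
Proof.
split=> [|x y].
  rewrite -clbas0 cllift_bas /clprod big1_seq // => i _; by rewrite ffunE.
rewrite [in LHS](clmodelE x) [in LHS](clmodelE y) [in RHS]/cllift.
rewrite mulr_suml linear_sum mulr_suml; apply: eq_bigr => A _.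
rewrite mulr_sumr linear_sum mulr_sumr; apply: eq_bigr => C _.
rewrite -scalerAl -scalerAr !linearZ /= clbasM [cllift (_ *: _)]linearZ /=.
rewrite cllift_bas.
rewrite -scalerAl -scalerAr (clprodM lift_sqr lift_anti) ?enum_uniq //.
by case: csign; rewrite ?scaleN1r ?mulN1r ?scale1r ?mul1r.
Qed.

Lemma cllift_iota : cllift \o cliota =1 f.
Proof.
move=> v /=; rewrite /cliota linear_sum /= [in RHS](row_sum_delta v) linear_sum.
apply: eq_bigr => i _; rewrite !linearZ /= cllift_bas; congr (_ *: _).
by rewrite clprod_sing ?enum_uniq // mem_enum.
Qed.

End Lift.

Lemma clbas_prod A : clbas A = clprod (clbas \o @sing n) (enum 'I_n) A.
Proof.
suff H s s0 : s0 ++ s = enum 'I_n ->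
    clprod (clbas \o @sing n) s A = clbas (restr s A).
  rewrite (H (enum 'I_n) [::]) //; congr clbas.
  by apply/ffunP => i; rewrite ffunE mem_enum.
elim: s s0 => [|i s IH] s0 E; rewrite /clprod ?big_nil ?big_cons.
  by rewrite -clbas0; congr clbas; apply/ffunP => i; rewrite !ffunE.
rewrite -/(clprod _ _ _) (IH (rcons s0 i)) ?cat_rcons //.
have us : uniq (s0 ++ i :: s) by rewrite E enum_uniq.
have iNs : i \notin s by move: us; rewrite cat_uniq => /and3P[_ _ /andP[]].
case Ai: (A i) => /=.
  rewrite clbasM -E csign_restr // scale1r; congr clbas; apply/ffunP => j.
  rewrite !ffunE in_cons.
  by case: eqP => [->|_] /=; rewrite ?(negbTE iNs) ?Ai.
rewrite mul1r; congr clbas; apply/ffunP => j; rewrite !ffunE in_cons.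
by case: eqP => [->|_] //=; rewrite (negbTE iNs) Ai.
Qed.

Lemma clmodel_clifford : clifford_algebra cliota.
Proof.
split; [exact: cliota_inj | exact: cliota_clifford | move=> B f fP].
pose F : {lrmorphism clmodel -> B} := HB.pack (cllift f)
  (GRing.isMonoidMorphism.Build clmodel B (cllift f) (cllift_monoid fP)).
exists F => [|F' F'f x]; first exact: cllift_iota.
rewrite [in LHS](clmodelE x) linear_sum; apply: eq_bigr => A _.
rewrite linearZ /= clbas_prod rmorph_prod; congr (_ *: _).
apply: eq_bigr => i _; case: (A i); rewrite ?rmorph1 //=.
by rewrite -cliota_delta -F'f.
Qed.

End CliffordModel.

Lemma clifford_algebra_exists (R : realType) (n : nat) :
  exists (A : falgType R) (iota : {linear 'rV[R]_n -> A}),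
    clifford_algebra iota.
Proof. by exists (clmodel R n), (@cliota R n); exact: clmodel_clifford. Qed.

Lemma clifford_conj_exists (R : realType) (n : nat) (A : algType R)
    (iota : {linear 'rV[R]_n -> A}) :
  clifford_algebra iota ->
  exists2 c : {lrmorphism A -> A^c}, clifford_conj iota c
    & forall c' : {lrmorphism A -> A^c}, clifford_conj iota c' -> c' =1 c.
Proof.
case=> _ iP iU.
pose f (v : 'rV[R]_n) : A^c := - iota v.
have f_lin : linear f by move=> a u v; rewrite /f linearP opprD scalerN.
pose fL : {linear 'rV[R]_n -> A^c} :=
  HB.pack f (GRing.isLinear.Build R 'rV[R]_n A^c _ f f_lin).
have fP : clifford_map fL.
  by move=> v; rewrite -iP; exact: (@mulrNN A (iota v) (iota v)).
have [c cE cU] := iU _ fL fP.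
have ciota v : c (iota v) = - iota v by exact: (cE v).
exists c => [|c' [_ c'E]]; last by apply: cU => v; exact: c'E.
split=> //.
pose cc (x : A) : A := c (c x : A).
have cc_lin : linear cc.
  move=> a u v; rewrite /cc.
  have -> : c (a *: u + v) = (a *: (c u : A) + (c v : A)) :> A.
    by rewrite linearP.
  by rewrite linearP.
have cc_mon : monoid_morphism cc.
  split=> [|u v]; first by rewrite /cc rmorph1 (rmorph1 c).
  by rewrite /cc antiM antiM.
pose ccF : {lrmorphism A -> A} := HB.pack cc
  (GRing.isLinear.Build R A A _ cc cc_lin)
  (GRing.isMonoidMorphism.Build A A cc cc_mon).
have [G GE GU] := iU _ iota iP.
have ccK : cancel c (c : A -> A).
  move=> x; rewrite -[LHS]/(ccF x) (GU ccF) => [|v]; last first.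
    rewrite /= /cc ciota.
    have -> : c (- iota v) = - (c (iota v) : A) :> A by rewrite rmorphN.
    by rewrite ciota opprK.
  pose idF : {lrmorphism A -> A} := idfun.
  by rewrite -[RHS]/(idF x) (GU idF).
by exists (c : A -> A).
Qed.

(* Main.v *)
(* The Clifford algebra of a form with signs is a matrix algebra with its
   conjugate transpose as soon as the matrix algebra is generated by pairwise
   anticommuting [*]-unitary elements of square [1] or [-1] in the right number:
   the induced morphism is onto, and the dimensions agree.  Writing (p, q) for p
   generators of square 1 and q of square -1, passing from [A] to the 2 x 2
   matrices over [A] turns (p, q) into (p + 1, q + 1) or into (q + 2, p), and
   four generators of square 1 can be traded for four of square -1.  Hence
   (0, q) becomes (4, q + 4), then (0, q + 8), after four doublings, and
   the eight cases start from R, C, H, R x R and H x H with the obvious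
   generators.  As the standard anti-automorphism sends every generator to its
   inverse, it corresponds to the conjugate transpose, so [G_n] is the unitary
   group of the matrix algebra.

   Compactness is seen in the Clifford algebra itself: the coefficient of [1] in
   [x * c x] is the sum of the squares of the coordinates of [x] in the basis of
   products of generators, so [G_n] is bounded. *)

Require Import Defs.
From HB Require Import structures.
From mathcomp Require Import all_boot all_order all_algebra.
From mathcomp Require Import falgebra complex ring.
From mathcomp Require Import boolp classical_sets reals topology normedtype.

Set Implicit Arguments.
Unset Strict Implicit.
Unset Printing Implicit Defensive.

Import Order.TTheory GRing.Theory Num.Theory.
Import numFieldNormedType.Exports.
Local Open Scope classical_set_scope.
Local Open Scope ring_scope.

(** * Matrix algebras with involution *)

(** One interface for the coefficient rings R, C, H, R x R and H x H. Centrality of [scal] makes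
    matrices an R-algebra; with [star_scal] it also makes the conjugate transpose R-linear. *)
Record star_ring (R : comNzRingType) := StarRing {
  star_sort :> nzRingType;
  star : {rmorphism star_sort -> star_sort^c};
  scal : {rmorphism R -> star_sort};
  starK : involutive (star : star_sort -> star_sort);
  scalC : forall a x, scal a * x = x * scal a;
  star_scal : forall a, star (scal a) = scal a }.

Section MatrixAlgebra.
Variables (R : comNzRingType) (E : star_ring R) (m : nat).

(* ['M[E]_m.+1] is already a left module over [E]; the alias makes it an algebra
   over [R]. *)
Definition mxalg := 'M[E]_m.+1.
HB.instance Definition _ := GRing.NzRing.on mxalg.
Implicit Types (a b : R) (u v : mxalg).

Definition mxalg_scale a u : mxalg := scal E a *: (u : 'M[E]_m.+1).

Fact mxalg_scaleA a b u :
  mxalg_scale a (mxalg_scale b u) = mxalg_scale (a * b) u.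
Proof. by rewrite /mxalg_scale scalerA rmorphM. Qed.
Fact mxalg_scale1 : left_id 1 mxalg_scale.
Proof. by move=> u; rewrite /mxalg_scale rmorph1 scale1r. Qed.
Fact mxalg_scaleDr : right_distributive mxalg_scale +%R.
Proof. by move=> a u v; rewrite /mxalg_scale scalerDr. Qed.
Fact mxalg_scaleDl u : {morph mxalg_scale^~ u : a b / a + b}.
Proof. by move=> a b; rewrite /mxalg_scale rmorphD scalerDl. Qed.
HB.instance Definition _ := GRing.Zmodule_isLmodule.Build R mxalg
  mxalg_scaleA mxalg_scale1 mxalg_scaleDr mxalg_scaleDl.

Fact mxalg_scalerAl a u v : a *: (u * v) = (a *: u) * v.
Proof. exact: (@scalemxAl _ _ _ _ (scal E a) u v). Qed.
HB.instance Definition _ :=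
  GRing.Lmodule_isLalgebra.Build R mxalg mxalg_scalerAl.

Fact mxalg_scalerAr a u v : a *: (u * v) = u * (a *: v).
Proof.
apply/matrixP => i j; rewrite !mxE mulr_sumr; apply: eq_bigr => k _.
by rewrite !mxE !mulrA scalC.
Qed.
HB.instance Definition _ :=
  GRing.Lalgebra_isAlgebra.Build R mxalg mxalg_scalerAr.

Definition mxstar : mxalg -> mxalg^c := @conjtr E (star E) m.+1.
HB.instance Definition _ := GRing.RMorphism.on mxstar.

Lemma mxstarK : involutive (mxstar : mxalg -> mxalg).
Proof. by move=> u; apply/matrixP => i j; rewrite !mxE starK. Qed.

Fact mxstar_scalable : scalable (mxstar : mxalg -> mxalg^c).
Proof.
move=> a u; apply/matrixP => i j.
by rewrite !mxE antiM star_scal scalC.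
Qed.
HB.instance Definition _ :=
  GRing.isScalable.Build R mxalg mxalg^c *:%R mxstar mxstar_scalable.

End MatrixAlgebra.

(** * Systems of Clifford generators *)

Inductive generated (R : comNzRingType) (A : algType R) (X : seq A) : A -> Prop :=
| gen_in x of x \in X : generated X x
| gen_1 : generated X 1
| gen_Z a x of generated X x : generated X (a *: x)
| gen_D x y of generated X x & generated X y : generated X (x + y)
| gen_M x y of generated X x & generated X y : generated X (x * y).

Lemma gen_N (R : comNzRingType) (A : algType R) (X : seq A) x :
  generated X x -> generated X (- x).
Proof. by rewrite -scaleN1r; exact: gen_Z. Qed.

Lemma gen_image (R : comNzRingType) (A B : algType R) (f : {lrmorphism A -> B})
    (X : seq A) (Y : seq B) :
  (forall x, x \in X -> generated Y (f x)) ->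
  forall x, generated X x -> generated Y (f x).
Proof.
move=> XY x; elim=> {x} [x /XY //||a x _|x y _ IHx _ IHy|x y _ IHx _ IHy].
- by rewrite rmorph1; exact: gen_1.
- by rewrite linearZ; exact: gen_Z.
- by rewrite rmorphD; exact: gen_D.
- by rewrite rmorphM; exact: gen_M.
Qed.

Lemma gen_trans (R : comNzRingType) (A : algType R) (X Y : seq A) :
  (forall x, x \in X -> generated Y x) ->
  forall x, generated X x -> generated Y x.
Proof. exact: (@gen_image _ _ _ (idfun : {lrmorphism A -> A})). Qed.

Definition anticommute (A : pzRingType) (x y : A) := x * y == - (y * x).

Lemma anticommuteC (A : pzRingType) : symmetric (@anticommute A).
Proof. by move=> x y; rewrite /anticommute -eqr_oppLR eq_sym. Qed.

Section CliffordSystem.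
Variables (R : comNzRingType) (A : algType R) (s : {lrmorphism A -> A^c}).
Implicit Types (x y z : A) (p q : seq A).

(* No independence is required of the products of generators: that the system
   presents [A] as a Clifford algebra is left to a comparison of dimensions. *)
Definition clifford_system p q :=
  [/\ [&& pairwise (@anticommute A) p, pairwise (@anticommute A) q
        & allrel (@anticommute A) p q],
      {in p, forall x, x * x = 1 /\ s x = x},
      {in q, forall x, x * x = -1 /\ s x = - x}
    & forall x, generated (p ++ q) x].

(* Up to sign, the four new generators are the old ones multiplied by the product
   of all four, with which each of them anticommutes. *)
Lemma clifford_system_switch p q :
  clifford_system p q -> size p = 4%N ->
  exists2 q', clifford_system [::] q' & size q' = (size q + 4)%N.
Proof.
case: p => [|a [|b [|c [|d [|? ?]]]]] // [] /and3P[ap aq apq] Hp Hq gen _.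
move: ap apq; rewrite /= !allrel_consl allrel0l !andbT -!andbA.
move=> /and4P[ab ac ad /and3P[bc bd cd]] /and4P[/allP aq' /allP bq /allP cq /allP dq].
(* [sw] and [sq] also give the variants with a trailing factor, as words are kept right-associated.
   [norm] then sorts the letters a, b, c, d up to sign and cancels squares, so identities between
   words follow by rewriting. *)
have sw x y : anticommute x y ->
    (y * x = - (x * y)) * (forall z, y * (x * z) = - (x * (y * z))).
  rewrite anticommuteC => /eqP yx.
  by split=> // z; rewrite mulrA yx mulNr mulrA.
have sq x : x * x = 1 -> (x * x = 1) * (forall z, x * (x * z) = z).
  by move=> xx; split=> // z; rewrite mulrA xx mul1r.
have [a2 sa] := Hp a (mem_head _ _).
have [b2 sb] : b * b = 1 /\ s b = b by apply: Hp; rewrite !inE eqxx !orbT.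
have [c2 sc] : c * c = 1 /\ s c = c by apply: Hp; rewrite !inE eqxx !orbT.
have [d2 sd] : d * d = 1 /\ s d = d by apply: Hp; rewrite !inE eqxx !orbT.
have norm := (sw _ _ ab, sw _ _ ac, sw _ _ ad, sw _ _ bc, sw _ _ bd, sw _ _ cd,
  sq _ a2, sq _ b2, sq _ c2, sq _ d2, @mulrN A, @mulNr A, @opprK A, @mulr1 A).
have sM x y : s (x * y) = (s y : A) * (s x : A) :> A by exact: antiM.
(* Reversing a triple of anticommuting letters costs the sign -1, so each triple has square -1 and
   is negated by [s]. Passing an element of [q] across a triple takes three swaps, again a minus
   sign. *)
pose r := [:: b * (c * d); a * (c * d); a * (b * d); a * (b * c)].
exists (r ++ q); last by rewrite size_cat addnC.
split=> //.
- apply/and3P; split=> //; rewrite pairwise_cat aq andbT.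
  rewrite !allrel_consl allrel0l /= !andbT; apply/and4P; split.
  + apply/and4P; split; apply/allP => x xq; have := (sw _ _ (aq' _ xq),
      sw _ _ (bq _ xq), sw _ _ (cq _ xq), sw _ _ (dq _ xq)) => xN;
    by apply/eqP; rewrite -!mulrA !(xN, norm).
  + by apply/and3P; split; apply/eqP; rewrite -!mulrA !norm.
  + by apply/andP; split; apply/eqP; rewrite -!mulrA !norm.
  + by apply/eqP; rewrite -!mulrA !norm.
- move=> x; rewrite mem_cat => /orP[|/Hq //]; rewrite !inE.
  by move=> /or4P[] /eqP->; rewrite !sM ?sa ?sb ?sc ?sd -!mulrA !norm.
move=> x; rewrite cat0s; apply: (gen_trans _ (gen x)) => {}x.
rewrite mem_cat => /orP[|xq]; last first.
  by apply: gen_in; rewrite mem_cat xq orbT.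
have Xr y : y \in r -> generated (r ++ q) y.
  by move=> yr; apply: gen_in; rewrite mem_cat yr.
have {}Xr : [/\ generated (r ++ q) (b * (c * d)), generated (r ++ q) (a * (c * d)),
    generated (r ++ q) (a * (b * d)) & generated (r ++ q) (a * (b * c))].
  by split; apply: Xr; rewrite !inE eqxx ?orbT.
(* An old generator is, up to sign, the product of the three triples containing it: each other
   letter occurs twice there and cancels. *)
case: Xr => Xa Xb Xc Xd; rewrite !inE => /or4P[] /eqP->.
- have -> : a = - (a * (c * d) * (a * (b * d)) * (a * (b * c))).
    by rewrite -!mulrA !norm.
  by apply: gen_N; apply: gen_M => //; apply: gen_M.
- have -> : b = - (b * (c * d) * (a * (b * d)) * (a * (b * c))).
    by rewrite -!mulrA !norm.
  by apply: gen_N; apply: gen_M => //; apply: gen_M.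
- have -> : c = - (b * (c * d) * (a * (c * d)) * (a * (b * c))).
    by rewrite -!mulrA !norm.
  by apply: gen_N; apply: gen_M => //; apply: gen_M.
- have -> : d = - (b * (c * d) * (a * (c * d)) * (a * (b * d))).
    by rewrite -!mulrA !norm.
  by apply: gen_N; apply: gen_M => //; apply: gen_M.
Qed.

End CliffordSystem.

(** * Clifford systems in A tensored with the real 2 x 2 matrices *)

Section Doubling.
Variables (R : comNzRingType) (A B : algType R).
Variables (s : {lrmorphism A -> A^c}) (t : {lrmorphism B -> B^c}).
(** The 2 x 2 matrices are given by relations only: [g] behaves like diag(1, -1), [d] like the
    rotation by a right angle, and both commute with the copy [j] of A. *)
Variables (j : {lrmorphism A -> B}) (g d : B).
Hypothesis tj : forall x, t (j x) = j (s x : A).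
Hypotheses (jg : forall x, j x * g = g * j x) (jd : forall x, j x * d = d * j x).
Hypotheses (g2 : g * g = 1) (d2 : d * d = -1) (gd : d * g = - (g * d)).
Hypotheses (tg : t g = g) (td : t d = - d).
Hypothesis span : forall y : B, exists a b c e,
  y = j a + j b * g + j c * d + j e * (g * d).

Let gg x : g * (g * x) = x. Proof. by rewrite mulrA g2 mul1r. Qed.
Let dd x : d * (d * x) = - x. Proof. by rewrite mulrA d2 mulN1r. Qed.
Let dg x : d * (g * x) = - (g * (d * x)). Proof. by rewrite mulrA gd mulNr mulrA. Qed.
Let jgA a x : j a * (g * x) = g * (j a * x). Proof. by rewrite mulrA jg mulrA. Qed.
Let jdA a x : j a * (d * x) = d * (j a * x). Proof. by rewrite mulrA jd mulrA. Qed.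
Let norm := (jgA, jdA, jg, jd, gg, dd, dg, gd, g2, d2, @mulrN B, @mulNr B, @opprK B).

Let tM (x y : B) : t (x * y) = (t y : B) * (t x : B) :> B.
Proof. exact: antiM. Qed.

Let gen_span (X : seq B) : generated X g -> generated X d ->
  (forall x, generated X (j x)) -> forall y, generated X y.
Proof.
move=> Xg Xd Xj y; have [a [b [c [e ->]]]] := span y.
by do !apply: gen_D; rewrite ?mulrA; do ?apply: gen_M.
Qed.

(** As [g] is self-adjoint of square 1 and commutes with [j x], the factor [g] keeps the square and
    the adjoint sign of each old generator. It also makes them anticommute with [g * d] and [d], the
    new generators of square 1 and -1. Generation holds because [g] is [- (g * d * d)], and then
    [j x] is [g * (g * j x)]. *)
Lemma clifford_system_double p q : clifford_system s p q ->
  clifford_system t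
    (g * d :: [seq g * j x | x <- p]) (d :: [seq g * j x | x <- q]).
Proof.
case=> /and3P[pp qq pq] Hp Hq gen.
have sub : subrel (@anticommute A) (relpre (fun x => g * j x) (@anticommute B)).
  by move=> x y /eqP xy; apply/eqP; rewrite -!mulrA !norm -!rmorphM xy rmorphN ?norm.
have a0 : anticommute (g * d) d by apply/eqP; rewrite -!mulrA !norm.
have a1 x : anticommute (g * d) (g * j x).
  by apply/eqP; rewrite -!mulrA !norm.
have a2 x : anticommute d (g * j x) by apply/eqP; rewrite -!mulrA !norm.
split.
- rewrite /= allrel_consl /= allrel_consr !all_map !pairwise_map.
  rewrite allrel_mapl allrel_mapr.
  rewrite (sub_pairwise sub pp) (sub_pairwise sub qq) /=.
  rewrite (sub_allrel sub pq).
  rewrite a0 /= !andbT.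
  apply/and4P; split; apply/allP => x _ /=; rewrite ?a1 ?a2 //.
  by rewrite anticommuteC a2.
- move=> y; rewrite inE => /predU1P[->|/mapP[x /Hp[x2 sx] ->]].
    by rewrite tM tg td -!mulrA !norm.
  by rewrite tM tj tg sx -!mulrA !norm -rmorphM x2 rmorph1.
- move=> y; rewrite inE => /predU1P[->|/mapP[x /Hq[x2 sx] ->]].
    by rewrite td d2.
  by rewrite tM tj tg sx -!mulrA !norm -rmorphM x2 !rmorphN !rmorph1 !norm.
set X := _ ++ _.
have Xd : generated X d by apply: gen_in; rewrite /X !(inE, mem_cat) eqxx !orbT.
have Xg : generated X g.
  have -> : g = - ((g * d) * d) by rewrite -mulrA !norm mulr1.
  by apply: gen_N; apply: gen_M => //; apply: gen_in; rewrite !inE eqxx.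
apply: gen_span => // x; apply: (gen_image _ (gen x)) => {}x xpq.
rewrite -[j x]gg; apply: gen_M => //; apply: gen_in.
rewrite /X !(inE, mem_cat); move: xpq; rewrite mem_cat => /orP[] h.
  by rewrite (map_f (fun x => g * j x) h) ?orbT.
by rewrite (map_f (fun x => g * j x) h) ?orbT.
Qed.

(** Here the factor is [d], skew of square -1, so squares and adjoint signs of the old generators
    are reversed and [p], [q] change places. The elements [g * d] and [g], both of square 1,
    anticommute with every [d * j x]. *)
Lemma clifford_system_double_swap p q : clifford_system s p q ->
  clifford_system t
    (g * d :: g :: [seq d * j x | x <- q]) [seq d * j x | x <- p].
Proof.
case=> /and3P[pp qq pq] Hp Hq gen.
have sub : subrel (@anticommute A) (relpre (fun x => d * j x) (@anticommute B)).
  by move=> x y /eqP xy; apply/eqP; rewrite -!mulrA !norm -!rmorphM xy rmorphN ?norm.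
have a0 : anticommute (g * d) g by apply/eqP; rewrite -!mulrA !norm.
have a1 x : anticommute (g * d) (d * j x).
  by apply/eqP; rewrite -!mulrA !norm.
have a2 x : anticommute g (d * j x) by apply/eqP; rewrite -!mulrA !norm.
split.
- rewrite /= !allrel_consl !all_map !pairwise_map.
  rewrite allrel_mapl allrel_mapr allrelC.
  rewrite (sub_pairwise sub pp) (sub_pairwise sub qq) /=.
  rewrite (sub_allrel _ pq); last first.
    by move=> x y xy /=; rewrite anticommuteC; exact: sub.
  rewrite a0 /= !andbT -!andbA.
  by apply/and4P; split; apply/allP => x _ /=; rewrite ?a1 ?a2.
- move=> y; rewrite !inE => /or3P[/eqP->|/eqP->|/mapP[x /Hq[x2 sx] ->]].
  + by rewrite tM tg td -!mulrA !norm.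
  + by rewrite tg g2.
  by rewrite tM tj td sx -!mulrA !norm -rmorphM x2 !rmorphN !rmorph1 !norm.
- move=> y /mapP[x /Hp[x2 sx] ->].
  by rewrite tM tj td sx -!mulrA !norm -rmorphM x2 !rmorph1.
set X := _ ++ _.
have Xg : generated X g by apply: gen_in; rewrite /X !(inE, mem_cat) eqxx !orbT.
have Xd : generated X d.
  by rewrite -[d]gg; apply: gen_M => //; apply: gen_in; rewrite !inE eqxx.
apply: gen_span => // x; apply: (gen_image _ (gen x)) => {}x xpq.
have -> : j x = - (d * (d * j x)) by rewrite !norm.
apply: gen_N; apply: gen_M => //; apply: gen_in.
rewrite /X !(inE, mem_cat); move: xpq; rewrite mem_cat => /orP[] h.
  by rewrite (map_f (fun x => d * j x) h) ?orbT.
by rewrite (map_f (fun x => d * j x) h) ?orbT.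
Qed.

End Doubling.

(** * Doubling the size of matrices *)

Section MatrixDoubling.
Variables (R : numFieldType) (E : star_ring R) (m : nat).
Local Notation A := (mxalg E m).
Local Notation B := (mxalg E (m + m.+1)).
Implicit Types a b c d : A.

(** The size [(m + m.+1).+1] of B is convertible to [m.+1 + m.+1], which is why a block matrix has
    type B and the block lemmas apply by conversion. *)
Definition blk a b c d : B :=
  @block_mx E m.+1 m.+1 m.+1 m.+1 a b c d.

Lemma blkM a b c d a' b' c' d' : blk a b c d * blk a' b' c' d' =
  blk (a * a' + b * c') (a * b' + b * d') (c * a' + d * c') (c * b' + d * d').
Proof. exact: (@mulmx_block E m.+1 m.+1 m.+1 m.+1 m.+1 m.+1). Qed.

Lemma blkD a b c d a' b' c' d' : blk a b c d + blk a' b' c' d' =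
  blk (a + a') (b + b') (c + c') (d + d').
Proof. exact: (@add_block_mx E m.+1 m.+1 m.+1 m.+1). Qed.

Lemma blkN a b c d : - blk a b c d = blk (- a) (- b) (- c) (- d).
Proof. exact: (@opp_block_mx E m.+1 m.+1 m.+1 m.+1). Qed.

Lemma blkZ (r : R) a b c d :
  r *: blk a b c d = blk (r *: a) (r *: b) (r *: c) (r *: d).
Proof. exact: (@scale_block_mx E m.+1 m.+1 m.+1 m.+1). Qed.

Lemma blk1 : 1 = blk 1 0 0 1.
Proof. exact: (@scalar_mx_block E m.+1 m.+1 1). Qed.

Lemma mxstar_blk a b c d : mxstar (blk a b c d) =
  blk (mxstar a : A) (mxstar c : A) (mxstar b : A) (mxstar d : A) :> B.
Proof.
have E1 (n1 n2 : nat) (u : 'M[E]_(n1, n2)) :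
  \matrix_(i, j) (star E (u j i) : E) = (map_mx (star E : E -> E) u)^T.
  by apply/matrixP => i j; rewrite !mxE.
rewrite /mxstar /conjtr !E1 /blk.
rewrite (@map_block_mx _ _ _ m.+1 m.+1 m.+1 m.+1).
exact: (@tr_block_mx _ m.+1 m.+1 m.+1 m.+1).
Qed.

Lemma blkP (u : B) : exists a b c d, u = blk a b c d.
Proof.
by do 4![eexists]; exact: (esym (@submxK E m.+1 m.+1 m.+1 m.+1 u)).
Qed.

Definition diagblk a : B := blk a 0 0 a.

Fact diagblk_linear : linear diagblk.
Proof. by move=> r a b; rewrite /diagblk blkZ blkD scaler0 addr0. Qed.
HB.instance Definition _ := GRing.isLinear.Build R A B *:%R diagblk diagblk_linear.

Fact diagblk_monoid : monoid_morphism diagblk.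
Proof.
split=> [|a b]; first by rewrite /diagblk -blk1.
by rewrite /diagblk blkM !mulr0 !mul0r !addr0 !add0r.
Qed.
HB.instance Definition _ := GRing.isMonoidMorphism.Build A B diagblk diagblk_monoid.

Lemma clifford_mx_double (p q : seq A) : clifford_system (@mxstar R E m) p q ->
  (exists p' q' : seq B, [/\ clifford_system (@mxstar R E (m + m.+1)) p' q',
     size p' = (size p).+1 & size q' = (size q).+1]) /\
  (exists p' q' : seq B, [/\ clifford_system (@mxstar R E (m + m.+1)) p' q',
     size p' = (size q).+2 & size q' = size p]).
Proof.
pose g : B := blk 1 0 0 (-1); pose d : B := blk 0 (-1) 1 0.
pose norm := (blkM, blkN, mulr0, mul0r, mulr1, mul1r, mulrN1, mulN1r, addr0,
  add0r, oppr0, opprK).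
have tj a : mxstar (diagblk a) = diagblk (mxstar a : A) :> B.
  by rewrite /diagblk mxstar_blk !(rmorph0 (@mxstar R E m)).
have jg a : diagblk a * g = g * diagblk a by rewrite /g /diagblk !norm.
have jd a : diagblk a * d = d * diagblk a by rewrite /d /diagblk !norm.
have g2 : g * g = 1 by rewrite /g !norm -blk1.
have d2 : d * d = -1 by rewrite /d blk1 !norm.
have gd : d * g = - (g * d) by rewrite /g /d !norm.
have s0 : mxstar (0 : A) = 0 :> A := rmorph0 (@mxstar R E m).
have s1 : mxstar (1 : A) = 1 :> A := rmorph1 (@mxstar R E m).
have sN1 : mxstar (- 1 : A) = - 1 :> A by rewrite (rmorphN (@mxstar R E m)) -[in RHS]s1.
have tg : mxstar g = g by rewrite /g mxstar_blk s0 s1 sN1.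
have td : mxstar d = - d by rewrite /d mxstar_blk s0 s1 sN1 !norm.
have span (y : B) : exists a b c e,
    y = diagblk a + diagblk b * g + diagblk c * d + diagblk e * (g * d).
  have [a [b [c [e ->]]]] := blkP y.
  have half (u v : A) : 2^-1 *: (u + v) + 2^-1 *: (u - v) = u.
    rewrite -scalerDr addrACA subrr addr0 -mulr2n -[u *+ 2]scaler_nat.
    rewrite scalerA mulVf ?scale1r //.
    by rewrite pnatr_eq0.
  have half' (u v : A) : 2^-1 *: (u + v) - 2^-1 *: (u - v) = v.
    by rewrite (addrC u) -(opprB v u) scalerN opprK half.
  (* The identity and [g] span the diagonal, [d] and [g * d = blk 0 (-1) (-1) 0] the antidiagonal;
     the coefficients solve these two 2 x 2 systems. *)
  exists (2^-1 *: (a + e)), (2^-1 *: (a - e)),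
    (2^-1 *: (c - b)), (- (2^-1 *: (c + b))).
  rewrite /diagblk /g /d !norm !blkD !norm; congr blk.
  - by rewrite half.
  - by rewrite addrC half'.
  - by rewrite addrC half.
  - by rewrite half'.
move=> pq; split; do 2!eexists; split.
- exact: (clifford_system_double tj jg jd g2 d2 gd tg td span pq).
- by rewrite /= size_map.
- by rewrite /= size_map.
- exact: (clifford_system_double_swap tj jg jd g2 d2 gd tg td span pq).
- by rewrite /= size_map.
- by rewrite /= size_map.
Qed.

End MatrixDoubling.

(** * From Clifford systems to group isomorphisms *)

Lemma group_isomorphic_trans (G H K : groupType) :
  group_isomorphic G H -> group_isomorphic H K -> group_isomorphic G K.
Proof.
move=> [f ?] [g ?]; exists (g \o f : {multiplicative G -> K}).
exact: bij_comp.
Qed.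

Section UnitaryIso.
Variables (A B : pzRingType) (s : {rmorphism A -> A^c}) (t : {rmorphism B -> B^c}).
Variables (f : {rmorphism A -> B}) (g : B -> A).
Hypotheses (fK : cancel f g) (gK : cancel g f).
Hypothesis fs : forall x, f (s x : A) = t (f x).

Lemma in_unitary_image x : in_unitary t (f x) = in_unitary s x.
Proof.
by rewrite /in_unitary -fs -!rmorphM -(rmorph1 f) !(can_eq fK).
Qed.

Lemma unitary_isomorphic : group_isomorphic (unitary s) (unitary t).
Proof.
have fU (x : unitary s) : in_unitary t (f (val x)).
  by rewrite in_unitary_image; case: x.
have gU (y : unitary t) : in_unitary s (g (val y)).
  by rewrite -in_unitary_image gK; case: y.
pose F (x : unitary s) : unitary t := Unitary (fU x).
have FM : {morph F : x y / (x * y)%g >-> (x * y)%g}.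
  by move=> x y; apply/val_inj; rewrite /= rmorphM.
pose FF : {multiplicative unitary s -> unitary t} :=
  HB.pack F (isMultiplicative.Build _ _ F FM).
exists FF; exists (fun y => Unitary (gU y)) => x; apply/val_inj => /=.
  exact: fK.
exact: gK.
Qed.

End UnitaryIso.

(** * Comparison with the explicit model, and the dimension *)

Section CliffordModelIso.
Variables (R : realType) (n : nat) (Cl : falgType R) (iota : {linear 'rV[R]_n -> Cl}).
Hypothesis Cl_univ : clifford_algebra iota.

(** Each universal property supplies one of the two morphisms, and uniqueness forces both composites
    to be the identity. *)
Lemma clifford_model_iso :
  exists (f : {lrmorphism Cl -> clmodel R n}) (g : {lrmorphism clmodel R n -> Cl}),
    [/\ cancel f g, cancel g f & f \o iota =1 @cliota R n].
Proof.
have [_ iP iU] := Cl_univ; have [_ jP jU] := clmodel_clifford R n.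
have [f fi _] := iU _ _ jP; have [g gj _] := jU _ _ iP.
exists f, g; split=> // x.
  have [h hi hU] := iU _ _ iP; rewrite -[RHS]/((idfun : {lrmorphism Cl -> Cl}) x).
  rewrite -[LHS]/((g \o f : {lrmorphism Cl -> Cl}) x) !hU // => v /=.
  by rewrite -[f _]/((f \o iota) v) fi -[RHS]gj.
pose M := clmodel R n.
have [h hi hU] := jU _ _ jP; rewrite -[RHS]/((idfun : {lrmorphism M -> M}) x).
rewrite -[LHS]/((f \o g : {lrmorphism M -> M}) x) !hU // => v /=.
by rewrite -[g _]/((g \o @cliota R n) v) gj -[RHS]fi.
Qed.

(** The dimension is read off the model, whose coordinates are indexed by the subsets of ['I_n], and
    carried over by linear injections in both directions. *)
Lemma clifford_dim : \dim {:Cl} = (2 ^ n)%N.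
Proof.
have [f [g [fK gK _]]] := clifford_model_iso.
have dimM : \dim {:clmodel R n} = (2 ^ n)%N.
  by rewrite dimvf /dim /= card_ffun card_bool card_ord muln1.
have le (U V : vectType R) (h : {linear U -> V}) : injective h ->
    (\dim {:U} <= \dim {:V})%N.
  move=> hI; have hI' : lker (linfun h) == 0%VS.
    by apply/lker0P => x y; rewrite !lfunE; exact: hI.
  rewrite -(@limg_dim_eq _ _ _ (linfun h)) ?dimvS ?subvf //.
  by rewrite (eqP hI') capv0.
apply/eqP; rewrite -dimM eqn_leq.
by rewrite (le _ _ f (can_inj fK)) (le _ _ g (can_inj gK)).
Qed.

End CliffordModelIso.

Lemma surj_inj_dim (R : fieldType) (U V : vectType R) (h : {linear U -> V}) :
  (forall y, exists x, h x = y) -> \dim {:U} = \dim {:V} -> injective h.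
Proof.
move=> hS dimE.
have hE : (linfun h @: fullv = fullv)%VS.
  apply/eqP; rewrite eqEsubv subvf /=; apply/subvP => y _.
  by have [x <-] := hS y; rewrite -lfunE memv_img ?memvf.
have := limg_ker_dim (linfun h) fullv; rewrite hE dimE capfv => /eqP.
rewrite -[X in _ == X]add0n eqn_add2r dimv_eq0 => /lker0P hI x y xy.
by apply: hI; rewrite !lfunE.
Qed.

(** A linear surjection onto a space of dimension d bounds the dimension of E from below without a
    vector space structure on E. A lower bound suffices to turn the surjection from the Clifford
    algebra into an injection. *)
Definition dim_at_least (R : realType) (E : star_ring R) d :=
  exists (V : vectType R) (k : {additive E -> V}),
   [/\ forall y, exists x, k x = y, forall a x, k (scal E a * x) = a *: k x
     & \dim {:V} = d].

Definition clifford_type (R : realType) (E : star_ring R) (a p q : nat) :=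
  exists m (P Q : seq (mxalg E m)),
   [/\ m.+1 = (2 ^ a)%N, clifford_system (@mxstar R E m) P Q, size P = p
     & size Q = q].

(** * From a system of generators of square -1 to an isomorphism *)

Section CliffordSystemIso.
Variables (R : realType) (n : nat) (Cl : falgType R) (iota : {linear 'rV[R]_n -> Cl}).
Variable c : {lrmorphism Cl -> Cl^c}.
Hypotheses (Cl_univ : clifford_algebra iota) (c_conj : clifford_conj iota c).

Section System.
Variables (A : algType R) (s : {lrmorphism A -> A^c}).
Hypothesis sK : involutive (s : A -> A).
Variable Q : seq A.
Hypotheses (Qsys : clifford_system s [::] Q) (Qn : size Q = n).

(** The morphism extends the linear map sending the i-th basis vector to the i-th element of [Q]; it
    is onto because [Q] generates. It intertwines the involutions because [s \o f \o c], with its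
    two reversals, is again a morphism and agrees with [f] on vectors. *)
Lemma clifford_system_morphism : exists f : {lrmorphism Cl -> A},
  (forall y, exists x, f x = y) /\ forall x, f (c x : Cl) = s (f x).
Proof.
have [/and3P[_ Qanti _] _ Qsqr Qgen] := Qsys.
pose h (v : 'rV[R]_n) : A := \sum_i v 0 i *: Q`_i.
have h_lin : linear h.
  move=> r u v; rewrite /h scaler_sumr -big_split; apply: eq_bigr => i _ /=.
  by rewrite !mxE scalerDl scalerA.
pose hL : {linear 'rV[R]_n -> A} :=
  HB.pack h (GRing.isLinear.Build R 'rV[R]_n A _ h h_lin).
have QE (i : 'I_n) : Q`_i \in Q by rewrite mem_nth ?Qn.
have anti (i j : 'I_n) : i != j -> Q`_i * Q`_j = - (Q`_j * Q`_i).
  wlog ij : i j / (i < j)%N => [W|_].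
    move=> ne; have := ne; rewrite neq_ltn => /orP[/W->//|ji].
    by rewrite (W j i) // ?opprK // eq_sym.
  by apply/eqP; apply: (pairwiseP 0 Qanti); rewrite ?inE ?Qn.
have hP : clifford_map hL.
  move=> v /=; rewrite {}/hL {h_lin}/h mulr_suml.
  have two : (2 : R) != 0 by rewrite pnatr_eq0.
  pose T i j := (v 0 i * v 0 j) *: (Q`_i * Q`_j : A).
  have E : \sum_i v 0 i *: Q`_i * (\sum_i v 0 i *: Q`_i) = \sum_i \sum_j T i j.
    apply: eq_bigr => i _; rewrite mulr_sumr.
    by apply: eq_bigr => j _; rewrite -scalerAl -scalerAr scalerA.
  (* Twice the square is the double sum plus its transpose, in which the off-diagonal terms cancel
     in pairs by anticommutation. *)
  apply: (scalerI two); rewrite !scaler_nat mulr2n.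
  rewrite {1}E exchange_big E -big_split /=.
  under eq_bigr => i _.
    rewrite -big_split /= (bigD1 i) //= big1 => [|j ji]; last first.
      by rewrite /T anti // mulrC scalerN addNr.
    rewrite /T (Qsqr _ (QE i)).1 addr0 -mulr2n scalerN -scaleNr.
    over.
  by rewrite sumrMnl -scaler_suml sumrN.
have [_ _ iU] := Cl_univ; have [f fi _] := iU _ _ hP.
have fc x : f (c x : Cl) = s (f x).
  pose g x : A := s (f (c x : Cl)).
  have g_lin : linear g.
    move=> a u v; rewrite /g.
    have -> : c (a *: u + v) = (a *: (c u : Cl) + (c v : Cl)) :> Cl.
      by rewrite linearP.
    by rewrite linearP linearP.
  have g_mon : monoid_morphism g.
    split=> [|u v]; first by rewrite /g (rmorph1 c) rmorph1 (rmorph1 s).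
    by rewrite /g antiM rmorphM antiM.
  pose gL : {lrmorphism Cl -> A} := HB.pack g
    (GRing.isLinear.Build R Cl A _ g g_lin)
    (GRing.isMonoidMorphism.Build Cl A g g_mon).
  have [F _ FU] := iU _ _ hP.
  have gf : gL \o iota =1 hL.
    move=> v /=; rewrite /g (c_conj.2 v) rmorphN /= [f _]fi /=.
    rewrite (rmorphN s) /h (raddf_sum s) -sumrN; apply: eq_bigr => i _.
    apply: etrans (congr1 (fun x : A => - x) (linearZ_LR s (v 0 i) Q`_i)) _.
    rewrite -scalerN -[in RHS](opprK Q`_i); congr (_ *: - _).
    exact: (Qsqr _ (QE i)).2.
  by rewrite [in RHS](FU f fi) -(FU gL gf) /= /g sK.
exists f; split=> // y; elim: (Qgen y) => {y}.
- move=> y yQ; have iP : (index y Q < n)%N by rewrite -Qn index_mem.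
  exists (iota (delta_mx 0 (Ordinal iP))).
  rewrite [f _]fi /= /h (bigD1 (Ordinal iP)) //= big1 => [|j ji].
    by rewrite mxE !eqxx scale1r addr0 nth_index.
  by rewrite mxE (negbTE ji) andbF scale0r.
- by exists 1; rewrite rmorph1.
- by move=> a y _ [x <-]; exists (a *: x); rewrite linearZ.
- by move=> y z _ [x <-] _ [w <-]; exists (x + w); rewrite rmorphD.
- by move=> y z _ [x <-] _ [w <-]; exists (x * w); rewrite rmorphM.
Qed.

End System.

(** Applying [k] to every entry of [f x] gives a linear surjection from a space of dimension [2 ^ n]
    onto one of dimension [2 ^ (2 * a + b)]. These are equal, so the surjection is injective, hence
    so is [f]. *)
Lemma clifford_type_isomorphic (E : star_ring R) a b :
  dim_at_least E (2 ^ b)%N -> n = (2 * a + b)%N -> clifford_type E a 0 n ->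
  group_isomorphic (unitary c) (unitary (@conjtr E (star E) (2 ^ a))).
Proof.
move=> [V [k [kS kZ dimV]]] nE [m [P [Q [mE sys /size0nil P0 Qn]]]].
rewrite {P}P0 in sys.
have [f [fS fc]] := clifford_system_morphism (@mxstarK R E m) sys Qn.
pose W := {ffun 'I_m.+1 * 'I_m.+1 -> V}.
pose h (x : Cl) : W := [ffun ij => k ((f x : 'M[E]_m.+1) ij.1 ij.2)].
have h_lin : linear h.
  move=> r x y; apply/ffunP => ij; rewrite !ffunE -kZ -raddfD; congr (k _).
  by rewrite linearP mxE [X in X + _]mxE.
pose hL : {linear Cl -> W} := HB.pack h (GRing.isLinear.Build R Cl W _ h h_lin).
have fI : injective f.
  suff hI : injective hL.
    by move=> x y xy; apply: hI; apply/ffunP => ij; rewrite !ffunE xy.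
  apply: surj_inj_dim => [w|].
    have [g gE] := choice (fun ij => kS (w ij)).
    have [x xE] := fS (\matrix_(i, j) g (i, j)).
    by exists x; apply/ffunP => -[i j]; rewrite ffunE xE mxE gE.
  rewrite (clifford_dim Cl_univ) dimvf /dim /= card_prod card_ord.
  rewrite -[X in (_ * X)%N]dimvf dimV mE -!expnD; congr (2 ^ _)%N.
  by rewrite nE mul2n addnn.
have [g gE] := choice fS.
rewrite -mE; apply: (@unitary_isomorphic _ _ _ _ f g _ gE fc).
by move=> x; apply: fI; rewrite gE.
Qed.

End CliffordSystemIso.

(** * Real, complex and quaternionic systems *)

Section CliffordType.
Variables (R : realType) (E : star_ring R).

Lemma clifford_type_double a p q :
  clifford_type E a p q -> clifford_type E a.+1 p.+1 q.+1.
Proof.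
case=> m [P [Q [mE sys <- <-]]].
have [[P' [Q' [sys' P'n Q'n]]] _] := clifford_mx_double sys.
exists (m + m.+1)%N, P', Q'; split=> //.
by rewrite -addSn mE addnn expnS mul2n.
Qed.

Lemma clifford_type_double_swap a p q :
  clifford_type E a p q -> clifford_type E a.+1 q.+2 p.
Proof.
case=> m [P [Q [mE sys <- <-]]].
have [_ [P' [Q' [sys' P'n Q'n]]]] := clifford_mx_double sys.
exists (m + m.+1)%N, P', Q'; split=> //.
by rewrite -addSn mE addnn expnS mul2n.
Qed.

Lemma clifford_type_switch a q :
  clifford_type E a 4 q -> clifford_type E a 0 (q + 4).
Proof.
case=> m [P [Q [mE sys Pn <-]]].
have [Q' sys' Q'n] := clifford_system_switch sys Pn.
by exists m, [::], Q'.
Qed.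

Lemma clifford_type_periodic a q k :
  clifford_type E a 0 q -> clifford_type E (4 * k + a) 0 (8 * k + q).
Proof.
move=> h; elim: k => [|k IH]; first by rewrite !muln0.
have -> : (4 * k.+1 + a = (4 * k + a).+4)%N by rewrite mulnS.
have -> : (8 * k.+1 + q = (8 * k + q).+4 + 4)%N by rewrite mulnS addn4.
by apply: clifford_type_switch; do 4 apply: clifford_type_double.
Qed.

Definition scalar1 (x : E) : mxalg E 0 := x%:M.

Lemma scalar1M x y : scalar1 x * scalar1 y = scalar1 (x * y).
Proof. by rewrite /scalar1 scalar_mxM. Qed.

Lemma mxstar_scalar1 x : mxstar (scalar1 x) = scalar1 (star E x : E) :> mxalg E 0.
Proof. by apply/(@matrixP E 1 1) => i j; rewrite !mxE !ord1 !mulr1n. Qed.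

(** The base cases live in 1 x 1 matrices. Generation is phrased with closed predicates on E because
    [generated] needs an algebra, while E is a ring with a scalar embedding. *)
Lemma clifford_type_base (P Q : seq E) :
  [&& pairwise (@anticommute E) P, pairwise (@anticommute E) Q
    & allrel (@anticommute E) P Q] ->
  {in P, forall x, x * x = 1 /\ star E x = x} ->
  {in Q, forall x, x * x = -1 /\ star E x = - x} ->
  (forall S : E -> Prop,
     {in P ++ Q, forall x, S x} -> (forall a, S (scal E a)) ->
     (forall x y, S x -> S y -> S (x + y)) ->
     (forall x y, S x -> S y -> S (x * y)) -> forall x, S x) ->
  clifford_type E 0 (size P) (size Q).
Proof.
move=> /and3P[PP QQ PQ] HP HQ gen.
exists 0, (map scalar1 P), (map scalar1 Q); rewrite !size_map; split=> //.
have sub : subrel (@anticommute E) (relpre scalar1 (@anticommute (mxalg E 0))).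
  move=> x y /eqP xy; apply/eqP; rewrite !scalar1M xy.
  exact: (raddfN (@scalar_mx E 1)).
split.
- rewrite allrel_mapl allrel_mapr !pairwise_map.
  by rewrite (sub_pairwise sub PP) (sub_pairwise sub QQ) (sub_allrel sub PQ).
- move=> _ /mapP[x /HP[x2 sx] ->]; rewrite scalar1M x2; split=> //.
  by apply: etrans (mxstar_scalar1 x) _; rewrite sx.
- move=> _ /mapP[x /HQ[x2 sx] ->]; rewrite scalar1M x2.
  split; first exact: (raddfN (@scalar_mx E 1)).
  by apply: etrans (mxstar_scalar1 x) _; rewrite sx; exact: (raddfN (@scalar_mx E 1)).
move=> u; rewrite [u]mx11_scalar -[_%:M]/(scalar1 _) -map_cat.
move: (u 0 0); apply: gen => [x xPQ|a|x y Sx Sy|x y Sx Sy].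
- by apply: gen_in; exact: map_f.
- have -> : scalar1 (scal E a) = a *: 1 by exact: (esym (scalemx1 1 (scal E a))).
  by apply: gen_Z; exact: gen_1.
- have -> : scalar1 (x + y) = scalar1 x + scalar1 y.
    exact: (raddfD (@scalar_mx E 1)).
  exact: gen_D.
- by rewrite -scalar1M; exact: gen_M.
Qed.

End CliffordType.

Lemma pairwise_anticommute2 (A : pzRingType) (x y : A) :
  y * x = - (x * y) -> pairwise (@anticommute A) [:: x; y].
Proof. by move=> yx; rewrite /= !andbT anticommuteC; apply/eqP. Qed.

Lemma pairwise_anticommute3 (A : pzRingType) (x y z : A) :
  y * x = - (x * y) -> z * x = - (x * z) -> z * y = - (y * z) ->
  pairwise (@anticommute A) [:: x; y; z].
Proof.
move=> yx zx zy; rewrite /= !andbT -andbA !(anticommuteC _ z) (anticommuteC x).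
by apply/and3P; split; apply/eqP.
Qed.

(** A coordinate-free presentation of the quaternions, from which the systems in H and in H x H are
    both built. *)
Definition quaternion_units (R : comNzRingType) (H : star_ring R) (i j : H) :=
  [/\ i * i = -1 /\ star H i = - i, j * j = -1 /\ star H j = - j,
      j * i = - (i * j)
    & forall x : H, exists a b e d, x = scal H a + scal H b * i +
        scal H e * j + scal H d * (i * j)].

Section RealAndComplex.
Variable R : realType.

Definition real_star : star_ring R :=
  @StarRing R R (@conjR R) idfun (fun _ => erefl) (@mulrC R) (fun _ => erefl).

Fact conjCK : involutive (@conjC R : R[i] -> R[i]). Proof. exact: conjcK. Qed.
Fact conjC_scal (a : R) : @conjC R (real_complex R a) = real_complex R a.
Proof. exact: conjc_real. Qed.

Definition complex_star : star_ring R :=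
  @StarRing R R[i] (@conjC R) (real_complex R) conjCK
    (fun _ _ => mulrC _ _) conjC_scal.

Definition quat_scal (a : R) := Quat a 0 0 0.
Fact quat_scal_zmod : zmod_morphism quat_scal.
Proof. by move=> a b; congr Quat; rewrite /= subr0. Qed.
Fact quat_scal_monoid : monoid_morphism quat_scal.
Proof. by split=> // a b; congr Quat; rewrite /=; ring. Qed.
HB.instance Definition _ :=
  GRing.isZmodMorphism.Build R (quat R) quat_scal quat_scal_zmod.
HB.instance Definition _ :=
  GRing.isMonoidMorphism.Build R (quat R) quat_scal quat_scal_monoid.

Fact conjHK : involutive (@conjH R : quat R -> quat R).
Proof. by case=> a b c d; congr Quat; rewrite /= opprK. Qed.
Fact quat_scalC a x : quat_scal a * x = x * quat_scal a.
Proof. by case: x => *; congr Quat; rewrite /=; ring. Qed.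
Fact conjH_scal a : @conjH R (quat_scal a) = quat_scal a.
Proof. by congr Quat; rewrite /= oppr0. Qed.

Definition quat_star : star_ring R :=
  @StarRing R (quat R) (@conjH R) quat_scal conjHK quat_scalC conjH_scal.

Lemma real_dim : dim_at_least real_star 1.
Proof.
exists (R^o : vectType R), (idfun : {additive R -> R}).
by split=> [y||]; [exists y | | rewrite dimvf].
Qed.

Definition complex_coord (z : R[i]) : R^o * R^o := (complex.Re z, complex.Im z).
Fact complex_coord_zmod : zmod_morphism complex_coord.
Proof. by case=> ? ? []. Qed.
HB.instance Definition _ := GRing.isZmodMorphism.Build R[i] (R^o * R^o)%type
  complex_coord complex_coord_zmod.

Lemma complex_dim : dim_at_least complex_star 2.
Proof.
exists (R^o * R^o : vectType R)%type, complex_coord.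
split=> [[a b]|a [b d]|]; last by rewrite dimvf.
  by exists (Complex a b).
by congr pair; rewrite /= !mul0r ?subr0 ?addr0.
Qed.

Definition quat_coord (z : quat R) : R^o * R^o * R^o * R^o := quat_tuple z.
Fact quat_coord_zmod : zmod_morphism quat_coord.
Proof. by case=> ? ? ? ? []. Qed.
HB.instance Definition _ := GRing.isZmodMorphism.Build (quat R)
  (R^o * R^o * R^o * R^o)%type quat_coord quat_coord_zmod.

Lemma quat_dim : dim_at_least quat_star 4.
Proof.
exists (R^o * R^o * R^o * R^o : vectType R)%type, quat_coord.
split=> [[[[a b] e] d]|a [b b' b'' b''']|]; last by rewrite dimvf.
  by exists (Quat a b e d).
have -> : quat_scal a * Quat b b' b'' b''' =
    Quat (a * b) (a * b') (a * b'') (a * b''').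
  by congr Quat => /=; ring.
by [].
Qed.

Lemma real_type : clifford_type real_star 0 0 0.
Proof. by apply: (@clifford_type_base R real_star [::] [::]) => // S _ SR _ _. Qed.

Lemma complex_type : clifford_type complex_star 0 0 1.
Proof.
pose i : R[i] := Complex 0 1.
apply: (@clifford_type_base R complex_star [::] [:: i]) => //.
  move=> _ /[!inE] /eqP->; split; congr Complex => /=; ring.
move=> S SQ SR SD SM [a b].
have -> : Complex a b = scal complex_star a + scal complex_star b * i.
  by congr Complex => /=; ring.
by apply: SD => //; apply: SM => //; apply: SQ; rewrite inE.
Qed.

Lemma quat_units : exists i j : quat_star, quaternion_units i j.
Proof.
exists (Quat 0 1 0 0), (Quat 0 0 1 0); split; try (split; congr Quat => /=; ring).
  by congr Quat => /=; ring.
by case=> a b e d; exists a, b, e, d; congr Quat => /=; ring.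
Qed.

Lemma quat_type : clifford_type quat_star 0 0 2.
Proof.
have [i [j [iP jP ji span]]] := quat_units.
apply: (@clifford_type_base R quat_star [::] [:: i; j]) => //.
- by apply/and3P; split; rewrite ?allrel0l //; exact: pairwise_anticommute2.
- by move=> x /[!inE] /orP[] /eqP->.
move=> S SQ SR SD SM x.
have Si : S i by apply: SQ; rewrite inE eqxx.
have Sj : S j by apply: SQ; rewrite !inE eqxx orbT.
have SZ r y : S y -> S (scal quat_star r * y) by move=> Sy; exact: SM.
have [a [b [e [d ->]]]] := span x.
exact: SD (SD _ _ (SD _ _ (SR _) (SZ _ _ Si)) (SZ _ _ Sj)) (SZ _ _ (SM _ _ Si Sj)).
Qed.

End RealAndComplex.

(** * Products of two coefficient rings *)

Section ProductStar.
Variables (R : realType) (E F : star_ring R).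

Definition pair_star (x : E * F) : (E * F)^c := (star E x.1 : E, star F x.2 : F).
Fact pair_star_zmod : zmod_morphism pair_star.
Proof. by move=> x y; rewrite /pair_star !rmorphB. Qed.
Fact pair_star_monoid : monoid_morphism pair_star.
Proof.
split; first by rewrite /pair_star !rmorph1.
by move=> x y; rewrite /pair_star !antiM.
Qed.
HB.instance Definition _ := GRing.isZmodMorphism.Build (E * F)%type (E * F)^c
  pair_star pair_star_zmod.
HB.instance Definition _ := GRing.isMonoidMorphism.Build (E * F)%type (E * F)^c
  pair_star pair_star_monoid.

Definition pair_scal (a : R) : E * F := (scal E a, scal F a).
Fact pair_scal_zmod : zmod_morphism pair_scal.
Proof. by move=> x y; rewrite /pair_scal !rmorphB. Qed.
Fact pair_scal_monoid : monoid_morphism pair_scal.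
Proof.
split; first by rewrite /pair_scal !rmorph1.
by move=> x y; rewrite /pair_scal !rmorphM.
Qed.
HB.instance Definition _ := GRing.isZmodMorphism.Build R (E * F)%type
  pair_scal pair_scal_zmod.
HB.instance Definition _ := GRing.isMonoidMorphism.Build R (E * F)%type
  pair_scal pair_scal_monoid.

Fact pair_starK : involutive (pair_star : E * F -> E * F).
Proof. by case=> x y; rewrite /pair_star /= !starK. Qed.
Fact pair_scalC a x : pair_scal a * x = x * pair_scal a.
Proof. by congr pair; rewrite /= scalC. Qed.
Fact pair_star_scal a : pair_star (pair_scal a) = pair_scal a.
Proof. by rewrite /pair_star /= !star_scal. Qed.

Definition prod_star : star_ring R :=
  @StarRing R (E * F)%type pair_star pair_scal pair_starK pair_scalC pair_star_scal.

Lemma prod_dim d e :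
  dim_at_least E d -> dim_at_least F e -> dim_at_least prod_star (d + e).
Proof.
move=> [V [k [kS kZ Vd]]] [W [l [lS lZ We]]].
pose h (x : E * F) : V * W := (k x.1, l x.2).
have h_add : zmod_morphism h by move=> x y; rewrite /h !raddfB.
pose hL : {additive E * F -> V * W} :=
  HB.pack h (GRing.isZmodMorphism.Build _ _ h h_add).
exists (V * W : vectType R)%type, hL; split.
- by move=> [y z]; have [[u <-] [v <-]] := (kS y, lS z); exists (u, v).
- by move=> a x; rewrite /= /h /= kZ lZ.
- by rewrite dimvf -Vd -We !dimvf.
Qed.

Section Unitary.
Variable m : nat.
Local Notation G := (unitary (@conjtr prod_star (star prod_star) m)).
Local Notation GE := (unitary (@conjtr E (star E) m)).
Local Notation GF := (unitary (@conjtr F (star F) m)).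

Definition mx_fst (M : 'M[E * F]_m) : 'M[E]_m := map_mx fst M.
Definition mx_snd (M : 'M[E * F]_m) : 'M[F]_m := map_mx snd M.
Definition mx_pair (M : 'M[E]_m) (N : 'M[F]_m) : 'M[E * F]_m :=
  \matrix_(i, j) (M i j, N i j).

Lemma mx_pairM M N M' N' : mx_pair M N * mx_pair M' N' = mx_pair (M * M') (N * N').
Proof.
apply/matrixP => i j; rewrite !mxE [RHS]surjective_pairing /=.
rewrite [LHS]surjective_pairing !raddf_sum.
by congr pair; apply: eq_bigr => k _; rewrite !mxE.
Qed.

Lemma mx_pair1 : mx_pair 1 1 = 1.
Proof. by apply/matrixP => i j; rewrite !mxE; case: (i == j). Qed.

Lemma conjtr_mx_pair M N : @conjtr prod_star (star prod_star) m (mx_pair M N) =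
  mx_pair (@conjtr E (star E) m M) (@conjtr F (star F) m N) :> 'M_m.
Proof. by apply/matrixP => i j; rewrite !mxE. Qed.

Lemma mx_pair_inj M N M' N' : mx_pair M N = mx_pair M' N' -> M = M' /\ N = N'.
Proof.
by move/matrixP => eqMN; split; apply/matrixP => i j;
  have := eqMN i j; rewrite !mxE => -[].
Qed.

Lemma mx_pairE M : M = mx_pair (mx_fst M) (mx_snd M).
Proof. by apply/matrixP => i j; rewrite !mxE -surjective_pairing. Qed.

Lemma in_unitary_pair M N :
  in_unitary (@conjtr prod_star (star prod_star) m) (mx_pair M N) =
  in_unitary (@conjtr E (star E) m) M && in_unitary (@conjtr F (star F) m) N.
Proof.
rewrite /in_unitary /= conjtr_mx_pair !mx_pairM -mx_pair1.
apply/idP/idP.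
  by move=> /andP[/eqP/mx_pair_inj[-> ->] /eqP/mx_pair_inj[-> ->]]; rewrite !eqxx.
by move=> /andP[/andP[/eqP-> /eqP->] /andP[/eqP-> /eqP->]]; rewrite !eqxx.
Qed.

(** Products and conjugate transposes of matrices over E x F are computed in each factor, so the
    unitarity equations split. This yields the product groups of the cases 8k+3 and 8k+7. *)
Lemma unitary_pair : group_isomorphic G (GE * GF)%type.
Proof.
have fU (x : G) : in_unitary (@conjtr E (star E) m) (mx_fst (val x)) /\
                  in_unitary (@conjtr F (star F) m) (mx_snd (val x)).
  by apply/andP; rewrite -in_unitary_pair -mx_pairE; case: x.
have gU (y : GE * GF) : in_unitary (@conjtr prod_star (star prod_star) m)
    (mx_pair (val y.1) (val y.2)).
  by rewrite in_unitary_pair; case: y => [[? ?] [? ?]]; apply/andP.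
pose f (x : G) : (GE * GF)%type := (Unitary (fU x).1, Unitary (fU x).2).
have fM : {morph f : x y / (x * y)%g >-> (x * y)%g}.
  move=> x y; have := mx_pairM (mx_fst (val x)) (mx_snd (val x))
    (mx_fst (val y)) (mx_snd (val y)).
  rewrite -!mx_pairE [LHS]mx_pairE => /mx_pair_inj[xy1 xy2].
  by congr pair; apply: val_inj.
pose fL : {multiplicative G -> (GE * GF)%type} :=
  HB.pack f (isMultiplicative.Build _ _ f fM).
exists fL; exists (fun y => Unitary (gU y)).
  by move=> x; apply: val_inj; rewrite /= -mx_pairE.
by case=> y z; congr pair; apply: val_inj; apply/matrixP => i j; rewrite !mxE.
Qed.

End Unitary.
End ProductStar.

Section ProductTypes.
Variable R : realType.

(** Half the sum and half the difference of x and y serve as witnesses. Hence a subring of E x E is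
    everything once it contains the diagonal and [(1, -1)]. *)
Lemma pair_half (E : star_ring R) (x y : E) : exists h h' : E,
  (x, y) = (h, h) + (h', h') * (1, -1) :> E * E.
Proof.
have half z : scal E 2^-1 * (z + z) = z.
  rewrite -mulr2n -(mulr_natl z 2) mulrA -(rmorph_nat (scal E)) -rmorphM.
  by rewrite mulVf ?rmorph1 ?mul1r // pnatr_eq0.
exists (scal E 2^-1 * (x + y)), (scal E 2^-1 * (x - y)).
congr pair; rewrite /= ?mulr1 ?mulrN1.
  by rewrite -mulrDr addrACA subrr addr0 half.
by rewrite -mulrBr opprB (addrC x) addrACA subrr addr0 half.
Qed.

Lemma real_pair_type : clifford_type (prod_star (real_star R) (real_star R)) 0 1 0.
Proof.
pose w : R * R := (1, -1).
pose RR := prod_star (real_star R) (real_star R).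
apply: (@clifford_type_base R RR [:: w] [::]) => //.
  by move=> _ /[!inE] /eqP->; split=> //; congr pair; rewrite /= ?mulr1 //; ring.
move=> S Sw SR SD SM [x y].
have [h [h' ->]] := @pair_half (real_star R) x y.
by apply: SD (SR h) _; apply: SM (SR h') _; apply: Sw; rewrite inE.
Qed.

Lemma quat_pair_type : clifford_type (prod_star (quat_star R) (quat_star R)) 0 0 3.
Proof.
have [i [j [[i2 ci] [j2 cj] ji span]]] := quat_units R.
(* Generalizing hides the coordinates of quaternions; only the relations between i and j remain. *)
move: (quat_star R) i j i2 ci j2 cj ji span => H i j i2 ci j2 cj ji span.
pose HH := prod_star H H.
(* The opposite signs in [kk] separate the factors: [ii * jj * kk] is [- (1, -1)], whereas
   [(i * j, i * j)] would stay in the diagonal. *)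
pose ii : HH := (i, i); pose jj : HH := (j, j); pose kk : HH := (i * j, - (i * j)).
have jiA (x : H) : j * (i * x) = - (i * (j * x)) by rewrite mulrA ji mulNr mulrA.
have iiA (x : H) : i * (i * x) = - x by rewrite mulrA i2 mulN1r.
have jjA (x : H) : j * (j * x) = - x by rewrite mulrA j2 mulN1r.
pose norm := (i2, j2, ji, iiA, jjA, jiA, @mulrN H, @mulNr H, @opprK H, @mulr1 H).
have ck : star H (i * j) = - (i * j).
  by rewrite antiM [star H i]ci [star H j]cj !norm.
have ckN : star H (- (i * j)) = i * j.
  by apply: etrans (rmorphN (star H) (i * j)) _; rewrite ck opprK.
have pairE (x y x' y' : H) : x = x' -> y = y' -> (x, y) = (x', y') :> HH.
  by move=> -> ->.
have pairM (x y x' y' : H) : (x, y) * (x', y') = (x * x', y * y') :> HH by [].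
have pairN (x y : H) : - (x, y) = (- x, - y) :> HH by [].
have starP (x y : H) : star HH (x, y) = (star H x : H, star H y : H) :> HH by [].
have pair1 : 1 = (1, 1) :> HH by [].
apply: (@clifford_type_base R HH [::] [:: ii; jj; kk]) => //.
- apply/and3P; split; rewrite ?allrel0l //; apply: pairwise_anticommute3;
  by rewrite !pairM pairN; apply: pairE; rewrite ?mulNr -?mulrA !norm.
- move=> x /[!inE] /or3P[] /eqP->; split;
  by rewrite ?pairM ?starP ?pair1 pairN; apply: pairE; rewrite ?mulNr -?mulrA ?norm.
move=> S SQ SR SD SM [x y].
have Si : S ii by apply: SQ; rewrite !inE eqxx.
have Sj : S jj by apply: SQ; rewrite !inE eqxx !orbT.
have Sk : S kk by apply: SQ; rewrite !inE eqxx !orbT.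
have SZ r z : S z -> S (scal HH r * z) by move=> Sz; exact: SM.
have Sw : S (1, -1).
  have -> : (1, -1) = scal HH (-1) * (ii * jj * kk).
    by rewrite rmorphN rmorph1 mulN1r !pairM pairN; apply: pairE; rewrite -!mulrA !norm.
  exact: SZ (SM _ _ (SM _ _ Si Sj) Sk).
have Sdiag h : S (h, h).
  have [a [b [e [d ->]]]] := span h.
  exact: SD (SD _ _ (SD _ _ (SR _) (SZ _ _ Si)) (SZ _ _ Sj)) (SZ _ _ (SM _ _ Si Sj)).
have [h [h' ->]] := @pair_half H x y.
exact: SD (Sdiag h) (SM _ _ (Sdiag h') Sw).
Qed.

End ProductTypes.

(** * Compactness *)

Section CliffordCompact.
Variables (R : realType) (n : nat) (Cl : falgType R) (iota : {linear 'rV[R]_n -> Cl}).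
Variable c : {lrmorphism Cl -> Cl^c}.
Hypotheses (Cl_univ : clifford_algebra iota) (c_conj : clifford_conj iota c).
Local Notation index := {ffun 'I_n -> bool}.
Local Notation sgn A := ((-1) ^+ csign (enum 'I_n) A A : R).
Variables (f : {lrmorphism Cl -> clmodel R n}) (g : {lrmorphism clmodel R n -> Cl}).
Hypotheses (fK : cancel f g) (gK : cancel g f) (fiota : f \o iota =1 @cliota R n).

Lemma clbas_unitary (A : index) : g (clbas R A) * (c (g (clbas R A)) : Cl) = 1.
Proof.
pose u (x : Cl) := x * (c x : Cl) = 1.
have uM x y : u x -> u y -> u (x * y).
  by rewrite /u => ux uy; rewrite antiM mulrA -(mulrA x) uy mulr1.
have u1 : u 1 by rewrite /u mul1r (rmorph1 c).
rewrite -/(u _) clbas_prod rmorph_prod; apply: (big_ind u) => // i _.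
case: (A i) => /=; last by rewrite rmorph1.
have -> : g (clbas R (sing i)) = iota (delta_mx 0 i).
  by rewrite -[RHS]fK; congr (g _); rewrite [f _]fiota cliota_delta.
have [_ iP _] := Cl_univ.
rewrite /u [c _](c_conj.2 (delta_mx 0 i)) mulrN iP euclid_form_delta eqxx.
by rewrite scaleN1r opprK.
Qed.

Lemma index_addii (A : index) : A + A = 0.
Proof. by apply/ffunP => i; rewrite !ffunE; case: (A i). Qed.

(** By [clbas_unitary], conjugation inverts a basis vector, whose square is the sign [sgn A]. *)
Lemma conj_clbas (A : index) : c (g (clbas R A)) = sgn A *: g (clbas R A) :> Cl.
Proof.
have := congr1 (fun x => g (clbas R A) * x) (clbas_unitary A).
rewrite mulrA -rmorphM /= clbasM index_addii clbas0 linearZ rmorph1 mulr1 => E.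
by rewrite -[in RHS]E -scalerAl mul1r scalerA -signr_addb addbb scale1r.
Qed.

Lemma conj_coord (x : Cl) (A : index) :
  f (c x : Cl) A = sgn A * (f x A : R).
Proof.
have -> : (c x : Cl) = \sum_(B : index) (f x B * sgn B : R) *: g (clbas R B).
  rewrite -[in LHS](fK x) [in LHS](clmodelE (f x)) linear_sum (raddf_sum c).
  apply: eq_bigr => B _; rewrite -scalerA -conj_clbas linearZ /=.
  exact: (linearZ_LR c).
rewrite linear_sum sum_ffunE (bigD1 A) //= big1 => [|B BA].
  by rewrite linearZ /= gK !ffunE eqxx /GRing.scale /= mulr1 addr0 mulrC.
by rewrite linearZ /= gK !ffunE eq_sym (negbTE BA) /GRing.scale /= mulr0.
Qed.

Lemma coord_normq (x : Cl) :
  f (x * (c x : Cl)) 0 = \sum_(A : index) (f x A : R) ^+ 2.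
Proof.
rewrite rmorphM ffunE; apply: eq_bigr => A _.
(* Indices add modulo 2, so A pairs only with itself in the coefficient of 1; the sign of that
   product cancels the one from [c]. *)
have -> : 0 - A = A by apply/ffunP => i; rewrite !ffunE; case: (A i).
by rewrite conj_coord mulrCA !mulrA -signr_addb addbb mul1r expr2.
Qed.

Lemma unitary_coord_le1 (x : Cl) (A : index) : in_unitary c x -> `|f x A : R| <= 1.
Proof.
case/andP=> /eqP xU _; have := coord_normq x.
rewrite xU rmorph1 ffunE eqxx => nE; have {}nE : 1 = _ := nE.
rewrite -(@ler_pXn2r _ 2) ?nnegrE // expr1n real_normK ?num_real // [leRHS]nE.
rewrite (bigD1 A) //= lerDl; apply: sumr_ge0 => B _; exact: sqr_ge0.
Qed.

End CliffordCompact.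

(** In coordinates the map is a quadratic polynomial. It runs between row spaces because A itself
    carries no topology. *)
Lemma mul_linear_continuous (R : realType) (A : algType R) m k
    (u v : {linear 'rV[R]_m -> A}) (w : {linear A -> 'rV[R]_k}) :
  continuous (fun y => w (u y * v y)).
Proof.
have -> : (fun y => w (u y * v y)) = fun y => \sum_i \sum_j
    (y 0 i * y 0 j) *: w (u (delta_mx 0 i) * v (delta_mx 0 j)).
  apply/funext => y; rewrite {1 2}(row_sum_delta y) !linear_sum mulr_suml linear_sum.
  apply: eq_bigr => i _; rewrite mulr_sumr linear_sum; apply: eq_bigr => j _.
  by rewrite !linearZ /= -scalerAl -scalerAr scalerA linearZ.
apply: continuous_big => [|i _]; first exact: add_continuous.
apply: continuous_big => [|j _ y]; first exact: add_continuous.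
apply: (@continuousZr_tmp _ _ _ (fun z : 'rV[R]_m => z 0 i * z 0 j)).
by apply: continuousM; exact: coord_continuous.
Qed.

Lemma unitary_compact (R : realType) (n : nat) (Cl : falgType R)
    (iota : {linear 'rV[R]_n -> Cl}) (c : {lrmorphism Cl -> Cl^c}) :
  clifford_algebra iota -> clifford_conj iota c ->
  fd_compact [set g : Cl | in_unitary c g].
Proof.
move=> Cl_univ c_conj m phi [psi phiK psiK].
have [f [g [fK gK fiota]]] := clifford_model_iso Cl_univ.
have psi_lin : linear psi.
  by move=> a x y; apply: (can_inj phiK); rewrite linearP !psiK.
pose psiL : {linear 'rV[R]_m -> Cl} :=
  HB.pack psi (GRing.isLinear.Build R 'rV[R]_m Cl _ psi psi_lin).
have cpsi_lin : linear (fun y => c (psi y) : Cl).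
  by move=> a x y; rewrite psi_lin; apply: etrans (linearP c _ _ _) _.
pose cpsiL : {linear 'rV[R]_m -> Cl} :=
  HB.pack (fun y => c (psi y) : Cl) (GRing.isLinear.Build R 'rV[R]_m Cl _ _ cpsi_lin).
apply: bounded_closed_compact.
  (* A unitary element has coordinates of absolute value at most 1 in the basis of products, so the
     triangle inequality gives this bound. *)
  exists (\sum_(A : {ffun 'I_n -> bool}) `|phi (g (clbas R A))|).
  split; first exact: num_real.
  move=> M /ltW leM _ /= [x xU <-]; apply: le_trans leM.
  rewrite -[x]fK (clmodelE (f x)) !linear_sum; apply: (le_trans (ler_norm_sum _ _ _)).
  apply: ler_sum => A _; rewrite !linearZ /= normrZ ler_piMl //.
  exact: (unitary_coord_le1 Cl_univ c_conj fK gK fiota).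
(* Closedness: the two unitarity equations become preimages of a point under quadratic maps. *)
have -> : [set phi x | x in [set g : Cl | in_unitary c g]] =
   ((fun y => phi (psiL y * cpsiL y)) @^-1` [set phi 1] `&`
    (fun y => phi (cpsiL y * psiL y)) @^-1` [set phi 1]).
  apply/seteqP; split=> [_ [x /andP[/eqP x1 /eqP x2] <-]|y [/= y1 y2]].
    by rewrite /preimage /= phiK x1 x2.
  exists (psi y); rewrite ?psiK //=; apply/andP.
  by split; apply/eqP; apply: (can_inj phiK).
have closed1 (z : 'rV[R]_m) : closed [set z].
  exact/accessible_closed_set1/hausdorff_accessible/norm_hausdorff.
apply: closedI; apply: preimage_closed => // y _.
  exact: (@mul_linear_continuous R Cl m m psiL cpsiL phi y).
exact: (@mul_linear_continuous R Cl m m cpsiL psiL phi y).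
Qed.

Theorem theorem9p5 (R : realType) (n : nat) (n_gt0 : (0 < n)%N)
    (Cl : falgType R) (iota : {linear 'rV[R]_n -> Cl})
    (Cl_univ : clifford_algebra iota)
    (c : {lrmorphism Cl -> Cl^c}) (c_conj : clifford_conj iota c) :
  (forall k : nat,
    (n = (8 * k)%N ->
       group_isomorphic (unitary c) (orthogonal_group R (2 ^ (4 * k)))) /\
    (n = (8 * k + 1)%N ->
       group_isomorphic (unitary c) (unitary_group R (2 ^ (4 * k)))) /\
    (n = (8 * k + 2)%N ->
       group_isomorphic (unitary c) (symplectic_group R (2 ^ (4 * k)))) /\
    (n = (8 * k + 3)%N ->
       group_isomorphic (unitary c)
         (symplectic_group R (2 ^ (4 * k)) *
          symplectic_group R (2 ^ (4 * k)))%type) /\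
    (n = (8 * k + 4)%N ->
       group_isomorphic (unitary c) (symplectic_group R (2 ^ (4 * k + 1)))) /\
    (n = (8 * k + 5)%N ->
       group_isomorphic (unitary c) (unitary_group R (2 ^ (4 * k + 2)))) /\
    (n = (8 * k + 6)%N ->
       group_isomorphic (unitary c) (orthogonal_group R (2 ^ (4 * k + 3)))) /\
    (n = (8 * k + 7)%N ->
       group_isomorphic (unitary c)
         (orthogonal_group R (2 ^ (4 * k + 3)) *
          orthogonal_group R (2 ^ (4 * k + 3)))%type)) /\
  fd_compact [set g : Cl | in_unitary c g].
Proof.
split=> [k|]; last exact: unitary_compact Cl_univ c_conj.
(* The equation [q = 2 * a + b] is the dimension count for the case k = 0; a period adds 4 to the
   exponent of the size and 8 to q, which preserves it. *)
have bott (E : star_ring R) a b q : dim_at_least E (2 ^ b)%N ->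
    clifford_type E a 0 q -> q = (2 * a + b)%N -> n = (8 * k + q)%N ->
    group_isomorphic (unitary c) (unitary (@conjtr E (star E) (2 ^ (4 * k + a)))).
  move=> Ed Et qE nE.
  apply: (clifford_type_isomorphic Cl_univ c_conj Ed).
    by rewrite nE qE mulnDr mulnA addnA.
  by rewrite nE; exact: clifford_type_periodic.
(* Paths of types, each doubling adding 1 to the exponent of the size. Over R: (0,0), (2,0), (3,1),
   (4,2), (0,6). Over C: (0,1), (3,0), (4,1), (0,5). Over H: (0,2), (4,0), (0,4). Over R x R: (1,0),
   (2,1), (3,2), (4,3), (0,7). *)
have real6 : clifford_type (real_star R) 3 0 6.
  apply: (@clifford_type_switch _ _ _ 2); do 2 apply: clifford_type_double.
  by apply: clifford_type_double_swap; exact: real_type.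
have complex5 : clifford_type (complex_star R) 2 0 5.
  apply: (@clifford_type_switch _ _ _ 1); apply: clifford_type_double.
  by apply: clifford_type_double_swap; exact: complex_type.
have quat4 : clifford_type (quat_star R) 1 0 4.
  apply: (@clifford_type_switch _ _ _ 0).
  by apply: clifford_type_double_swap; exact: quat_type.
have real7 : clifford_type (prod_star (real_star R) (real_star R)) 3 0 7.
  apply: (@clifford_type_switch _ _ _ 3); do 3 apply: clifford_type_double.
  exact: real_pair_type.
have real2 := prod_dim (real_dim R) (real_dim R).
have quat2 := prod_dim (quat_dim R) (quat_dim R).
split=> [nE|].
  have := @bott (real_star R) 0 0 0 (real_dim R) (real_type R) erefl.
  by rewrite !addn0; apply.
split=> [nE|].
  have := @bott (complex_star R) 0 1 1 (complex_dim R) (complex_type R) erefl nE.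
  by rewrite addn0.
split=> [nE|].
  have := @bott (quat_star R) 0 2 2 (quat_dim R) (quat_type R) erefl nE.
  by rewrite addn0.
split=> [nE|].
  have := @bott _ 0 3 3 quat2 (quat_pair_type R) erefl nE.
  by rewrite addn0 => /group_isomorphic_trans; apply; exact: unitary_pair.
split=> [nE|]; first exact: (@bott (quat_star R) 1 2 4 (quat_dim R) quat4).
split=> [nE|]; first exact: (@bott (complex_star R) 2 1 5 (complex_dim R) complex5).
split=> [nE|nE]; first exact: (@bott (real_star R) 3 0 6 (real_dim R) real6).
apply: group_isomorphic_trans (@bott _ 3 1 7 real2 real7 erefl nE) _.
exact: unitary_pair.
Qed.
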